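(* Let $n\geq 2$ and let $D$ be a bounded domain in $\mathbb R^n$ with $C^1$-smooth boundary ($\partial D\in C^1$). Then $1_D\in A_p(\mathbb R^n)$ for all $p>2n/(n+1)$.
   Context: A domain is a (nonempty) open connected set. $1_D$ denotes the characteristic function of $D$ ($1_D(t)=1$ for $t\in D$, $1_D(t)=0$ for $t\notin D$). The Fourier transform is $\widehat f(\xi)=\int_{\mathbb R^n} f(t)e^{-i(\xi,t)}\,dt$ for integrable $f$, where $(\cdot,\cdot)$ is the inner product in $\mathbb R^n$, and is extended to tempered distributions as usual. For $1\leq p\leq\infty$, $A_p(\mathbb R^n)$ is the space of tempered distributions $f$ on $\mathbb R^n$ such that $\widehat f\in L^p(\mathbb R^n)$, with norm $\|f\|_{A_p(\mathbb R^n)}=\|\widehat f\|_{L^p(\mathbb R^n)}$. The boundary $\partial D$ is $C^1$-smooth, written $\partial D\in C^1$, if in an appropriate neighborhood of each of its points $\partial D$ is (after a suitable choice of orthonormal coordinates) the graph of a real function of class $C^1$, i.e. a function all of whose first-order partial derivatives are continuous. *)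

(* Defs.v *)
From HB Require Import structures.
From mathcomp Require Import all_boot all_order all_algebra.
From mathcomp Require Import all_classical all_reals all_analysis.
From mathcomp Require Import complex.

Set Implicit Arguments.
Unset Strict Implicit.
Unset Printing Implicit Defensive.

Import Order.TTheory GRing.Theory Num.Theory.
Import numFieldNormedType.Exports.

Local Open Scope classical_set_scope.
Local Open Scope ring_scope.
Local Open Scope complex_scope.

(* Row vectors carry the sigma-algebra generated by the coordinates, as
   tuples do in the library; for real entries it is the Borel one. *)
Section measurable_rV.
Context {d} {T : sigmaRingType d}.
Variable n : nat.

Let coors : 'I_n -> 'rV[T]_n -> T := fun i v => v 0 i.

Let rV_set0 : g_sigma_preimage coors set0.
Proof. exact: sigma_algebra0. Qed.

Let rV_setC A : g_sigma_preimage coors A -> g_sigma_preimage coors (~` A).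
Proof. exact: sigma_algebraC. Qed.

Let rV_bigcup (F : (set 'rV[T]_n)^nat) :
  (forall i, g_sigma_preimage coors (F i)) ->
  g_sigma_preimage coors (\bigcup_i (F i)).
Proof. exact: sigma_algebra_bigcup. Qed.

HB.instance Definition _ := @isMeasurable.Build (measure_tuple_display d)
  'rV[T]_n (g_sigma_preimage coors) rV_set0 rV_setC rV_bigcup.

End measurable_rV.

Lemma measurable_coord_rV d (T : sigmaRingType d) n (i : 'I_n) :
  measurable_fun [set: 'rV[T]_n] (fun v : 'rV[T]_n => v 0 i).
Proof.
move=> _ Y mY; rewrite setTI; apply: sub_sigma_algebra => /=.
rewrite -bigcup_seq/=; exists i => /=; first by rewrite mem_index_enum.
by exists Y => //; rewrite setTI.
Qed.

Lemma measurable_fun_rVP d1 d2 (T1 : measurableType d1)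
    (T2 : measurableType d2) n (f : T1 -> 'rV[T2]_n) :
  (forall i, measurable_fun [set: T1] (fun x => f x 0 i)) ->
  measurable_fun [set: T1] f.
Proof.
move=> mf _ A; rewrite setTI.
suff : measurable `<=` [set B | measurable (f @^-1` B)] by apply.
apply: smallest_sub.
  split => /= [|B mB|F mF]; first by rewrite preimage_set0.
    by rewrite setTD preimage_setC; apply: measurableC.
  by rewrite preimage_bigcup; exact: bigcupT_measurable.
move=> B; rewrite -bigcup_seq => -[i _ [C mC <-]] /=.
have := mf i measurableT C mC; rewrite !setTI; exact.
Qed.

Section lebesgue_rV.
Context {R : realType}.

Section lebesgue_consrV.
Variables (n : nat) (mu : {sigma_finite_measure set 'rV[R]_n -> \bar R}).

Definition consrV (xv : measurableTypeR R * 'rV[R]_n) : 'rV[R]_n.+1 :=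
  row_mx (const_mx xv.1 : 'rV[R]_1) xv.2.

Definition unconsrV (v : 'rV[R]_n.+1) : measurableTypeR R * 'rV[R]_n :=
  (v 0 0, rsubmx (v : 'rV_(1 + n))).

Lemma unconsrVK : cancel unconsrV consrV.
Proof.
move=> v; rewrite /consrV /unconsrV /=; apply/rowP => i.
rewrite mxE; case: splitP => j ij; rewrite !mxE; congr (v _ _).
  by apply/val_inj/esym; rewrite (ord1 j) in ij.
by apply/val_inj; exact/esym.
Qed.

Lemma consrVK : cancel consrV unconsrV.
Proof.
move=> [x v]; rewrite /consrV /unconsrV /= row_mxKr; congr pair.
by rewrite mxE; case: splitP => // j _; rewrite mxE.
Qed.

Lemma measurable_consrV : measurable_fun [set: _] consrV.
Proof.
apply: measurable_fun_rVP => i; under eq_fun do rewrite mxE.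
case: splitP => j _; first by under eq_fun do rewrite mxE; exact: measurable_fst.
apply: (measurableT_comp (f := fun v : 'rV[R]_n => v 0 j)) => //.
exact: measurable_coord_rV.
Qed.

Lemma measurable_unconsrV : measurable_fun [set: _] unconsrV.
Proof.
apply: measurable_fun_pair; first exact: measurable_coord_rV.
apply: measurable_fun_rVP => i.
under eq_fun do rewrite mxE.
exact: measurable_coord_rV.
Qed.

Definition lebesgue_consrV : set 'rV[R]_n.+1 -> \bar R :=
  pushforward (lebesgue_measure \x mu)%E consrV.

HB.instance Definition _ := Measure.copy lebesgue_consrV
  [the {measure set 'rV[R]_n.+1 -> \bar R} of
     measure_function_pushforward__canonical__measure_function_Measure
       (lebesgue_measure \x mu)%E measurable_consrV].

Lemma sigma_finite_lebesgue_consrV : sigma_finite [set: _] lebesgue_consrV.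
Proof.
have /sigma_finiteP[F [TF ndF Foo]] := sigma_finiteT (@lebesgue_measure R).
have /sigma_finiteP[G [TG ndG Goo]] := sigma_finiteT mu.
exists (fun k => unconsrV @^-1` (F k `*` G k)).
  apply/esym; rewrite -subTset => v _ /=.
  have [i _ Fi] : (\bigcup_i F i) (unconsrV v).1 by rewrite -TF.
  have [j _ Gj] : (\bigcup_i G i) (unconsrV v).2 by rewrite -TG.
  exists (maxn i j) => //; split.
    by move: Fi; exact/subsetPset/ndF/leq_maxl.
  by move: Gj; exact/subsetPset/ndG/leq_maxr.
move=> k; have [? ?] := Foo k; have [? ?] := Goo k; split.
  by rewrite -[X in measurable X]setTI; apply: measurable_unconsrV => //;
    exact: measurableX.
rewrite /lebesgue_consrV /pushforward -comp_preimage.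
rewrite (_ : unconsrV \o consrV = id); last first.
  by apply/funext => xv; exact: consrVK.
by rewrite preimage_id product_measure1E// lte_mul_pinfty// ge0_fin_numE.
Qed.

HB.instance Definition _ := @Measure_isSigmaFinite.Build _ _ _
  lebesgue_consrV sigma_finite_lebesgue_consrV.

End lebesgue_consrV.

Fixpoint lebesgue_rV n : {sigma_finite_measure set 'rV[R]_n -> \bar R} :=
  match n with
  | 0 => [the {sigma_finite_measure set 'rV[R]_0 -> \bar R} of
           dirac (0 : 'rV[R]_0)]
  | m.+1 => [the {sigma_finite_measure set 'rV[R]_m.+1 -> \bar R} of
              lebesgue_consrV (lebesgue_rV m)]
  end.

End lebesgue_rV.

Section domains.
Context {R : realType} {n : nat}.
Implicit Types (D V : set 'rV[R]_n).

Definition domain D := [/\ D !=set0, open D & connected D].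

Definition boundary D := closure D `\` interior D.

End domains.

Definition C1_on {R : realType} {m : nat} (W : set 'rV[R]_m)
    (phi : 'rV[R]_m -> R) :=
  forall y, W y -> forall i : 'I_m,
    derivable phi y (delta_mx 0 i) /\
    {for y, continuous ('D_(delta_mx 0 i) phi)}.

(* The entries of x *m Q are the coordinates of x in the orthonormal basis
   formed by the columns of Q; the k-th one is the dependent variable. *)
Definition C1_boundary {R : realType} {n : nat} (D : set 'rV[R]_n) :=
  forall a, boundary D a ->
  exists (V : set 'rV[R]_n) (Q : 'M[R]_n) (k : 'I_n)
         (W : set 'rV[R]_n.-1) (phi : 'rV[R]_n.-1 -> R),
    [/\ open_nbhs a V, Q *m Q^T = 1%:M, open W, C1_on W phi &
      boundary D `&` V =
        [set x | W (col' k (x *m Q)) /\ (x *m Q) 0 k = phi (col' k (x *m Q))]].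

Section fourier.
Context {R : realType} {n : nat}.
Implicit Types (f g phi : 'rV[R]_n -> R[i]).

Definition dot (x y : 'rV[R]_n) : R := \sum_i x 0 i * y 0 i.

(* e^(i theta) *)
Definition expi (theta : R) : R[i] := cos theta +i* sin theta.

Definition cintegral f : R[i] :=
  (\int[lebesgue_rV n]_x complex.Re (f x))%R +i*
  (\int[lebesgue_rV n]_x complex.Im (f x))%R.

Definition fourier f (xi : 'rV[R]_n) : R[i] :=
  cintegral (fun t => f t * expi (- dot xi t)).

Definition Lp (p : \bar R) g :=
  [/\ measurable_fun [set: 'rV[R]_n] (fun x => complex.Re (g x)),
      measurable_fun [set: 'rV[R]_n] (fun x => complex.Im (g x)) &
      ('N[lebesgue_rV n]_p [EFin \o @Normc.normc R \o g] < +oo)%E].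

(* Mixed partial derivatives are indexed by the sequence of the variables
   with respect to which one differentiates. *)
Definition pderiv (s : seq 'I_n) (u : 'rV[R]_n -> R) : 'rV[R]_n -> R :=
  foldr (fun i v => 'D_(delta_mx 0 i) v) u s.

Definition cpderiv (s : seq 'I_n) f (x : 'rV[R]_n) : R[i] :=
  pderiv s (fun y => complex.Re (f y)) x +i*
  pderiv s (fun y => complex.Im (f y)) x.

Definition smooth (u : 'rV[R]_n -> R) :=
  forall s, continuous (pderiv s u) /\
    forall x (i : 'I_n), derivable (pderiv s u) x (delta_mx 0 i).

Definition schwartz_norm (N : nat) f : \bar R :=
  ereal_sup [set y | exists (s : seq 'I_n) (x : 'rV[R]_n), (size s <= N)%N /\
    y = ((1 + `|x|) ^+ N * Normc.normc (cpderiv s f x))%:E].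

Definition schwartz f :=
  [/\ smooth (fun x => complex.Re (f x)), smooth (fun x => complex.Im (f x)) &
      forall N, (schwartz_norm N f < +oo)%E].

(* A tempered distribution is represented by a functional on all functions,
   of which only the values on the Schwartz space matter. *)
Definition tempered (T : ('rV[R]_n -> R[i]) -> R[i]) :=
  (forall (c : R[i]) phi psi, schwartz phi -> schwartz psi ->
    T (fun x => c * phi x + psi x) = c * T phi + T psi) /\
  exists (N : nat) (C : R), forall phi, schwartz phi ->
    ((Normc.normc (T phi))%:E <= C%:E * schwartz_norm N phi)%E.

(* The distribution given by a function. *)
Definition distr_of f phi : R[i] := cintegral (fun x => f x * phi x).

Definition fourier_distr (T : ('rV[R]_n -> R[i]) -> R[i]) phi : R[i] :=
  T (fourier phi).

(* T belongs to A_p(R^n); the space is defined for 1 <= p <= +oo only. *)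
Definition in_A (p : \bar R) (T : ('rV[R]_n -> R[i]) -> R[i]) :=
  tempered T /\
  exists2 g, Lp p g &
    forall phi, schwartz phi -> fourier_distr T phi = distr_of g phi.

End fourier.

(* Main.v *)
(* Since the C^1 hypersurface [boundary D] is covered by O(d^(1-n)) balls of
   radius d, the L^2 modulus of continuity of f = 1_D satisfies
   int |f(x + v) - f(x)|^2 dx = O(|v|). On the transform side f(x + v) - f(x)
   becomes multiplication by e^(i(v,xi)) - 1, which is bounded away from 0 for
   v of length 2^-k along a dominant coordinate of xi in the shell
   2^k < |xi| <= 2^(k+1). Bessel's inequality then gives
   int_(2^k < |xi| <= 2^(k+1)) |f^(xi)|^2 dxi = O(2^-k), and interpolating with
   the volume O(2^(kn)) of the shell bounds the integral of |f^|^(2s) over it by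
   the general term of a convergent geometric series when s > n/(n+1), s <= 1;
   larger exponents follow as f^ is bounded. Bessel's inequality itself, with
   a non-sharp constant, is proved on the line by integrating |f^|^2 against
   the window max(0, 1 - (s/N)^2), whose transform is dominated by the
   Poisson-like kernel N / (1 + (N z)^2), and in R^n by induction on n. *)

Require Import Defs.
From mathcomp Require Import all_boot all_order all_algebra.
From mathcomp Require Import all_classical all_reals all_analysis.
From mathcomp Require Import complex.
From mathcomp Require Import measurable_realfun ess_sup_inf ring lra.

Set Implicit Arguments.
Unset Strict Implicit.
Unset Printing Implicit Defensive.

Import Order.TTheory GRing.Theory Num.Theory.
Import numFieldNormedType.Exports.

Local Open Scope classical_set_scope.
Local Open Scope ring_scope.
Local Open Scope complex_scope.

(** * Integrals with a parameter *)

(** The norm of ['rV[R]_n] is the sup norm. Balls are therefore cubes, whose measure is known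
    exactly, and a dominant coordinate of xi has absolute value equal to the norm of xi; the price
    is that the rotation in the C^1 charts is only bi-Lipschitz for this norm. C^1 smoothness is
    converted into a box count of the boundary: the charts are locally Lipschitz graphs, and a
    Lipschitz graph is no harder to cover than a cube of dimension n - 1. The exponent: on the k-th
    shell, interpolation between the L^2 bound and the volume gives 2^(-ks) 2^(kn(1-s)) = 2^(k(n -
    (n+1)s)). This decays exactly when s > n/(n+1), and p = 2s. Only finiteness is claimed, so
    constants are free, and a one-sided Bessel inequality replaces Plancherel's identity. It comes
    from a Schur test with a majorant kernel whose mass does not depend on N. The transform of a
    real function is kept as two real integrals, against cos and sin, in accordance with
    [cintegral]. For signed integrands Fubini's hypothesis is always checked by domination by a
    product a(x) b(y). *)

Section param.
Context d1 d2 (X : measurableType d1) (Y : measurableType d2) (R : realType).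
Variable m2 : {sigma_finite_measure set Y -> \bar R}.

Lemma measurable_param_ge0_integral (F : X -> Y -> \bar R) :
  measurable_fun [set: X * Y] (fun z => F z.1 z.2) ->
  (forall x y, 0 <= F x y)%E ->
  measurable_fun [set: X] (fun x => \int[m2]_y F x y)%E.
Proof.
by move=> mF F0; exact: (@measurable_fun_fubini_tonelli_F _ _ _ _ R m2
  (fun z => F z.1 z.2)).
Qed.

(** Tonelli applies to the integrals of the positive and negative parts, and [fine] is measurable;
    parameters at which the integral diverges are simply sent to 0. *)
Lemma measurable_param_Rintegral (F : X -> Y -> R) :
  measurable_fun [set: X * Y] (fun z => F z.1 z.2) ->
  measurable_fun [set: X] (fun x => \int[m2]_y F x y).
Proof.
move=> mF; rewrite /Rintegral; apply: (@measurableT_comp _ _ _ _ _ _ (@fine R) _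
  (fun x => \int[m2]_y (F x y)%:E)%E) => //.
have mE : measurable_fun [set: X * Y] (fun z => (F z.1 z.2)%:E).
  exact/measurable_EFinP.
rewrite (_ : (fun x => \int[m2]_y (F x y)%:E)%E = fun x =>
  (\int[m2]_y maxe (F x y)%:E 0 - \int[m2]_y maxe (- (F x y)%:E) 0)%E).
  apply: emeasurable_funB; apply: (measurable_param_ge0_integral (F := fun _ _ => _)).
  - exact: measurable_maxe.
  - by move=> x y; rewrite le_max lexx orbT.
  - by apply: measurable_maxe => //; apply: measurableT_comp mE.
  - by move=> x y; rewrite le_max lexx orbT.
apply/funext => x; rewrite integralE.
congr (_ - _)%E; apply: eq_integral => y _; first by rewrite funeposE.
by rewrite funenegE.
Qed.

Lemma dominated_integrable (f a : Y -> R) :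
  measurable_fun [set: Y] f -> m2.-integrable [set: Y] (EFin \o a) ->
  (forall y, `|f y| <= a y) -> m2.-integrable [set: Y] (EFin \o f).
Proof.
move=> mf ia fa; apply: le_integrable ia => //; first exact/measurable_EFinP.
by move=> y _ /=; rewrite lee_fin (le_trans (fa y))// ler_norm.
Qed.

Variable m1 : {sigma_finite_measure set X -> \bar R}.

(** Product domination is pointwise, so it gives integrability of every section and not merely of
    almost every one. This matters for [Rintegral], where each inner integral passes through
    [fine]. *)
Lemma integrable_prod_dominated (F : X -> Y -> R) (a : X -> R) (b : Y -> R) :
  measurable_fun [set: X * Y] (fun z => F z.1 z.2) ->
  m1.-integrable [set: X] (EFin \o a) -> m2.-integrable [set: Y] (EFin \o b) ->
  (forall x y, `|F x y| <= a x * b y) ->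
  (m1 \x m2)%E.-integrable [set: X * Y] (fun z => (F z.1 z.2)%:E).
Proof.
move=> mF ia ib Fab.
have mE : measurable_fun [set: X * Y] (fun z => (F z.1 z.2)%:E).
  exact/measurable_EFinP.
apply/(integrable12ltyP _ _ mE) => /=.
have ia' := integrable_norm ia; have ib' := integrable_norm ib.
apply: (@le_lt_trans _ _ (\int[m1]_x (`|a x|%:E * \int[m2]_y `|b y|%:E))%E).
  apply: ge0_le_integral => //=.
  - by move=> x _; apply: integral_ge0.
  - apply: (@measurable_fun_fubini_tonelli_F _ _ _ _ R m2
      (fun z => `|(F z.1 z.2)%:E|%E)) => //.
    exact: measurableT_comp mE.
  - apply: emeasurable_funM; last exact: measurable_cst.
    by have /integrableP[] := ia'.
  - move=> x _; rewrite -ge0_integralZl//=; last by have /integrableP[] := ib'.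
    apply: ge0_le_integral => //=.
    + apply/measurable_EFinP; apply: measurableT_comp => //.
      exact: (measurable_fun_pair2 (f := fun z => F z.1 z.2) x mF).
    + apply: emeasurable_funM; first exact: measurable_cst.
      by have /integrableP[] := ib'.
    + move=> y _; rewrite -EFinM lee_fin -normrM.
      exact: le_trans (Fab _ _) (ler_norm _).
rewrite ge0_integralZr//=; last 2 first.
  by have /integrableP[] := ia'.
  exact: integral_ge0.
have /integrableP[_ ja] := ia; have /integrableP[_ jb] := ib.
by rewrite lte_mul_pinfty//; [exact: integral_ge0|rewrite ge0_fin_numE// integral_ge0].
Qed.

Lemma Rintegral_swap (F : X -> Y -> R) (a : X -> R) (b : Y -> R) :
  measurable_fun [set: X * Y] (fun z => F z.1 z.2) ->
  m1.-integrable [set: X] (EFin \o a) -> m2.-integrable [set: Y] (EFin \o b) ->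
  (forall x y, `|F x y| <= a x * b y) ->
  \int[m1]_x (\int[m2]_y F x y) = \int[m2]_y (\int[m1]_x F x y).
Proof.
move=> mF ia ib Fab.
have iF := integrable_prod_dominated mF ia ib Fab.
have := Fubini iF => /=.
rewrite /Rintegral => H; congr fine.
(* The inner integral is finite for every x, hence removing its [fine] is harmless and [Fubini] can
   be applied to extended integrals. *)
under eq_integral => x _.
  rewrite fineK; last first.
    apply: integrable_fin_num => //.
    apply: (@dominated_integrable _ (fun y => a x * b y)) => //.
      exact: (measurable_fun_pair2 (f := fun z => F z.1 z.2) x mF).
    exact (integrableZl measurableT (a x) ib).
  over.
rewrite H; apply: eq_integral => y _; rewrite fineK//.
apply: integrable_fin_num => //.
apply: (@le_integrable _ _ _ _ _ _ _ (fun x => (b y)%:E * (EFin \o a) x)%E) => //.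
- apply/measurable_EFinP; exact: (measurable_fun_pair1 (f := fun z => F z.1 z.2) y mF).
- by move=> x _; rewrite /= lee_fin mulrC (le_trans (Fab _ _))// ler_norm.
- exact: integrableZl.
Qed.

End param.

(** * Lebesgue measure on row vectors *)

Section translation1.
Context {R : realType}.
Local Notation leb := (@lebesgue_measure R).

Let measurable_addr (a : R) :
  measurable_fun [set: measurableTypeR R] ((fun x => x + a) : _ -> measurableTypeR R).
Proof. exact: (@measurable_funD _ R R). Qed.

(** The pushforward under translation agrees with Lebesgue measure on the intervals []u, v]], and
    these determine it. *)
Lemma lebesgue_measure_translation (a : R) (A : set R) : measurable A ->
  leb ((fun x => x + a) @^-1` A) = leb A.
Proof.
move=> mA; pose nu := measure_function_pushforward__canonical__measure_function_Measure
  leb (measurable_addr a).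
suff /(_ A mA) -> : forall B, measurable B -> leb B = nu B by [].
apply: lebesgue_measure_unique => _ [[u v] /= uv <-].
rewrite /nu /= /pushforward.
rewrite (_ : _ @^-1` _ = `]u - a, v - a]%classic); last first.
  by apply/seteqP; split => x /=; rewrite !in_itv /= ltrBlDr lerBrDr.
rewrite !lebesgue_measure_itv /= !lte_fin ltrD2r; case: ifPn => // _.
by rewrite -!EFinB; congr EFin; ring.
Qed.

Lemma ge0_integral_translation (a : R) (f : R -> \bar R) :
  measurable_fun [set: R] f -> (forall x, 0 <= f x)%E ->
  (\int[leb]_x f (x + a)%R = \int[leb]_x f x)%E.
Proof.
move=> mf f0.
have := @ge0_integral_pushforward _ _ (measurableTypeR R) (measurableTypeR R) R
  (fun x => x + a) (measurable_addr a) leb setT f measurableT mf (fun x _ => f0 x).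
rewrite preimage_setT => <-.
apply: eq_measure_integral => A mA _.
exact: lebesgue_measure_translation.
Qed.

End translation1.

Section rV.
Context {R : realType}.
Local Notation leb := (@lebesgue_measure R).
Local Notation mu n := (@lebesgue_rV R n).

Section step.
Variable n : nat.

Lemma ge0_integral_lebesgue_rVS (F : 'rV[R]_n.+1 -> \bar R) :
  measurable_fun [set: 'rV[R]_n.+1] F -> (forall v, 0 <= F v)%E ->
  (\int[mu n.+1]_v F v = \int[leb]_x \int[mu n]_y F (consrV (x, y)))%E.
Proof.
move=> mF F0.
transitivity (\int[(leb \x mu n)%E]_z (F \o @consrV R n) z)%E.
  have := @ge0_integral_pushforward _ _ _ _ R (@consrV R n) (@measurable_consrV R n)
    (leb \x mu n)%E setT F measurableT mF (fun x _ => F0 x).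
  by rewrite preimage_setT => <-.
apply: fubini_tonelli1; last by move=> x; exact: F0.
by apply: measurableT_comp => //; exact: measurable_consrV.
Qed.

Lemma Rintegral_lebesgue_rVS (F : 'rV[R]_n.+1 -> R) (a : R -> R)
    (b : 'rV[R]_n -> R) :
  measurable_fun [set: 'rV[R]_n.+1] F ->
  leb.-integrable [set: R] (EFin \o a) ->
  (mu n).-integrable [set: 'rV[R]_n] (EFin \o b) ->
  (forall x y, `|F (consrV (x, y))| <= a x * b y) ->
  \int[mu n.+1]_v F v = \int[leb]_x (\int[mu n]_y F (consrV (x, y))).
Proof.
move=> mF ia ib Fab.
have mF' : measurable_fun [set: measurableTypeR R * 'rV[R]_n]
    (fun z => F (consrV (z.1, z.2))).
  rewrite (_ : (fun z => _) = F \o @consrV R n); last by apply/funext => -[].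
  by apply: measurableT_comp => //; exact: measurable_consrV.
have iF := integrable_prod_dominated mF' ia ib Fab.
rewrite {1}/Rintegral.
transitivity (fine (\int[(leb \x mu n)%E]_z (F (consrV z))%:E)%E).
  congr fine.
  have := @integral_pushforward _ _ _ _ R (@consrV R n) (@measurable_consrV R n)
    (leb \x mu n)%E setT (EFin \o F).
  rewrite preimage_setT => <- //; first exact/measurable_EFinP.
rewrite /Rintegral; congr fine.
rewrite (_ : \int[_]_z _ = \int[(leb \x mu n)]_z (F (consrV (z.1, z.2)))%:E)%E; last first.
  by apply: eq_integral => -[].
have := integral12_prod_meas1 iF.
rewrite /fubini_F /= => <-.
apply: eq_integral => x _.
rewrite fineK//; apply: integrable_fin_num => //.
apply: (@dominated_integrable _ _ _ _ _ (fun y => a x * b y)) => //.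
  exact: (measurable_fun_pair2 (f := fun z => F (consrV (z.1, z.2))) x mF').
exact (integrableZl measurableT (a x) ib).
Qed.

End step.

Lemma consrVD n (x u : R) (y v : 'rV[R]_n) :
  consrV (x, y) + consrV (u, v) = consrV (x + u, y + v).
Proof. by apply/rowP => i; rewrite !mxE; case: splitP => j _; rewrite !mxE. Qed.

Lemma measurable_translation n (a : 'rV[R]_n) :
  measurable_fun [set: 'rV[R]_n] (fun v => v + a).
Proof.
apply: measurable_fun_rVP => i; under eq_fun do rewrite mxE.
by apply: measurable_funD => //; exact: measurable_coord_rV.
Qed.

Lemma ge0_integral_translation_rV n (a : 'rV[R]_n) (F : 'rV[R]_n -> \bar R) :
  measurable_fun [set: 'rV[R]_n] F -> (forall v, 0 <= F v)%E ->
  (\int[mu n]_v F (v + a)%R = \int[mu n]_v F v)%E.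
Proof.
elim: n a F => [|n IH] a F mF F0.
  by apply: eq_integral => v _; congr F; apply/rowP => -[].
have mFa : measurable_fun [set: 'rV[R]_n.+1] (fun v => F (v + a)).
  by apply: measurableT_comp => //; exact: measurable_translation.
rewrite (ge0_integral_lebesgue_rVS mFa (fun v => F0 _)) (ge0_integral_lebesgue_rVS mF F0).
have mF' : measurable_fun [set: measurableTypeR R * 'rV[R]_n]
    (fun z => F (consrV (z.1, z.2))).
  rewrite (_ : (fun z => _) = F \o @consrV R n); last by apply/funext => -[].
  by apply: measurableT_comp => //; exact: measurable_consrV.
(* The induction hypothesis absorbs the tail of [a] in the inner integral; its head is left to the
   one-dimensional translation. *)
transitivity (\int[leb]_x \int[mu n]_y F (consrV ((x : R) + (unconsrV a).1, y)%R))%E.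
  apply: eq_integral => x _.
  rewrite -[RHS](IH (unconsrV a).2)//.
    apply: eq_integral => y _; congr F.
    by rewrite -consrVD -[in LHS](unconsrVK a); case: (unconsrV a).
  exact: (measurable_fun_pair2 (f := fun z => F (consrV (z.1, z.2))) _ mF').
apply: (ge0_integral_translation _ (f := fun x => \int[mu n]_y F (consrV (x, y)))%E).
  apply: (measurable_param_ge0_integral (mu n) (F := fun x y => F (consrV (x, y)))) => //.
by move=> x; apply: integral_ge0.
Qed.

Lemma Rintegral_translation_rV n (a : 'rV[R]_n) (F : 'rV[R]_n -> R) :
  measurable_fun [set: 'rV[R]_n] F ->
  \int[mu n]_v F (v + a) = \int[mu n]_v F v.
Proof.
move=> mF; rewrite /Rintegral; congr fine; rewrite integralE [RHS]integralE.
have mE : measurable_fun [set: 'rV[R]_n] (fun z => (F z)%:E) by exact/measurable_EFinP.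
congr (_ - _)%E.
  rewrite -[RHS](ge0_integral_translation_rV a)//; last exact: measurable_funepos.
  by apply: eq_integral => v _; rewrite !funeposE.
rewrite -[RHS](ge0_integral_translation_rV a)//; last exact: measurable_funeneg.
by apply: eq_integral => v _; rewrite !funenegE.
Qed.

End rV.

Lemma integrable_indic_lty d (T : measurableType d) (R : realType)
    (m : {measure set T -> \bar R}) (A : set T) :
  measurable A -> (m A < +oo)%E -> m.-integrable [set: T] (EFin \o \1_A).
Proof.
move=> mA Aoo; apply/integrableP; split; first exact/measurable_EFinP.
under eq_integral do rewrite /= ger0_norm//.
by rewrite integral_indic// setIT.
Qed.

(** * Cubes, open sets and functions of bounded support *)

Section rV_measure.
Context {R : realType}.
Local Notation leb := (@lebesgue_measure R).
Local Notation mu n := (@lebesgue_rV R n).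

(** The sup norm in coordinates. For n = 0 the right side is vacuous and the norm is 0, hence the
    sign condition on r. *)
Lemma rV_norm_leP n (x : 'rV[R]_n) (r : R) : 0 <= r ->
  (`|x| <= r) <-> (forall i, `|x 0 i| <= r).
Proof.
move=> r0; rewrite [`|x|]/Num.Def.normr /= mx_normrE; split.
  by move=> /bigmax_leP[_ h] i; exact: (h (0, i)).
by move=> h; apply/bigmax_leP; split => // -[i j] _; rewrite ord1.
Qed.

Lemma rV_norm_coord n (x : 'rV[R]_n) i : `|x 0 i| <= `|x|.
Proof. by have /(rV_norm_leP x (normr_ge0 _))/(_ i) := lexx `|x|. Qed.

(** Supplies the dominant coordinate of a frequency in [shell_estimate]; positivity excludes n =
    0. *)
Lemma rV_norm_attained n (x : 'rV[R]_n) : 0 < `|x| -> exists i, `|x| = `|x 0 i|.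
Proof.
rewrite lt0r => /andP[x0 _].
have [[i j] /= h] := mx_norm_neq0 x0.
by exists j; rewrite [LHS]h ord1.
Qed.

Lemma measurable_coord_comp d (T : measurableType d) n (f : T -> 'rV[R]_n) i :
  measurable_fun [set: T] f -> measurable_fun [set: T] (fun x => f x 0 i).
Proof.
by move=> mf; apply: (measurableT_comp (f := fun v : 'rV[R]_n => v 0 i)) => //;
  exact: measurable_coord_rV.
Qed.

Lemma measurable_dot d (T : measurableType d) n (f g : T -> 'rV[R]_n) :
  measurable_fun [set: T] f -> measurable_fun [set: T] g ->
  measurable_fun [set: T] (fun x => dot (f x) (g x)).
Proof.
move=> mf mg; apply: measurable_sum => i.
by apply: measurable_funM; exact: measurable_coord_comp.
Qed.

Lemma measurable_closed_ball_rV n (c : 'rV[R]_n) (r : R) : 0 <= r ->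
  measurable [set x | `|x - c| <= r].
Proof.
move=> r0.
rewrite (_ : [set x | _] = \big[setI/setT]_(i < n)
    ((fun x : 'rV[R]_n => x 0 i) @^-1` `[c 0 i - r, c 0 i + r])); last first.
  rewrite -bigcap_seq; apply/seteqP; split => x /=.
    move=> /(rV_norm_leP _ r0) h i _ /=; move: (h i).
    by rewrite !mxE in_itv /= ler_norml; lra.
  move=> h; apply/(rV_norm_leP _ r0) => i.
  have := h i (mem_index_enum i); rewrite /= !mxE in_itv /= ler_norml; lra.
apply: bigsetI_measurable => i _; rewrite -[X in measurable X]setTI.
exact: measurable_coord_rV.
Qed.

(** Through [consrV] a cube is an interval times a cube of one dimension less, matching the
    recursion of [lebesgue_rV]; for n = 0 the value 1 is the Dirac mass. *)
Lemma lebesgue_closed_ball_rV n (c : 'rV[R]_n) (r : R) : 0 <= r ->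
  mu n [set x | `|x - c| <= r] = ((2 * r) ^+ n)%:E.
Proof.
move=> r0; elim: n c => [|n IH] c.
  rewrite expr0 /= diracE mem_set//=.
  by rewrite (_ : 0 - c = 0) ?normr0//; apply/rowP => -[].
rewrite /= /lebesgue_consrV /pushforward.
rewrite (_ : _ @^-1` _ = `[c 0 0 - r, c 0 0 + r] `*`
    [set y | `|y - (unconsrV c).2| <= r]); last first.
  apply/seteqP; split => -[x y] /=.
    move=> /(rV_norm_leP _ r0) h; split.
      have := h 0; rewrite !mxE; case: splitP => // j _.
      by rewrite mxE in_itv /= ler_norml; lra.
    apply/(rV_norm_leP _ r0) => i; have := h (rshift 1 i).
    by rewrite [consrV _]/(row_mx _ _) !mxE (unsplitK (inr _ i)).
  rewrite in_itv /= => -[h /(rV_norm_leP _ r0) h'].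
  apply/(rV_norm_leP _ r0) => i; rewrite !mxE.
  case: splitP => j ij.
    rewrite mxE (_ : i = 0); last by apply/val_inj => /=; rewrite ij ord1.
    by rewrite /= ler_norml; lra.
  have := h' j; rewrite !mxE; rewrite (_ : rshift 1 j = i)//.
  by apply/val_inj => /=; rewrite ij.
rewrite product_measure1E//; last exact: measurable_closed_ball_rV.
rewrite IH [X in (X * _)%E](_ : _ = lebesgue_measure `[c 0 0 - r, c 0 0 + r])//.
rewrite lebesgue_measure_itv /= lte_fin exprS EFinM.
have [rp|] := ltrP; first by congr (_ * _)%E; rewrite -EFinB; congr EFin; ring.
move=> h; have -> : r = 0 by lra.
by rewrite mulr0 mul0e.
Qed.

(** The sigma-algebra is generated by the coordinates, so open sets have to be recovered: U is the
    union of the countably many closed cubes with rational centre and radius 1/(k+1) that it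
    contains. *)
Lemma open_measurable_rV n (U : set 'rV[R]_n) : open U -> measurable U.
Proof.
move=> oU.
pose F (z : 'rV[rat]_n * nat) : set 'rV[R]_n :=
  [set x | `|x - map_mx ratr z.1| <= z.2.+1%:R^-1].
rewrite (_ : U = \bigcup_z (if `[< F z `<=` U >] then F z else set0)); last first.
  apply/seteqP; split => x; last first.
    by move=> [z _]; case: ifPn => // /asboolP; apply.
  move=> Ux; have /nbhs_ballP[e /= e0 eU] := open_nbhs_nbhs (conj oU Ux).
  (* Half of e, because two points of a cube of radius 1/(k+1) may be 2/(k+1) apart. *)
  have [k ke] : exists k : nat, k.+1%:R^-1 < e / 2.
    have : \forall k \near \oo, k.+1%:R^-1 < e / 2 :> R.
      by apply: near_infty_natSinv_lt (PosNum _); rewrite divr_gt0.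
    by case=> N _ /(_ N (leqnn _)); exists N.
  have k0 : 0 < k.+1%:R^-1 :> R by rewrite invr_gt0.
  have /choice[q hq] : forall i, exists q : rat,
      ratr q \in `]x 0 i - k.+1%:R^-1, x 0 i + k.+1%:R^-1[.
    by move=> i; apply: rat_in_itvoo; rewrite ltrBlDr -addrA ltrDl addr_gt0.
  have Fx : F (\row_i q i, k) x.
    apply/(rV_norm_leP _ (ltW k0)) => i; rewrite !mxE /=.
    have := hq i; rewrite in_itv /= ler_norml => /andP[].
    by move: (k.+1%:R^-1) => d; lra.
  exists (\row_i q i, k) => //.
  case: ifPn => // /asboolP[] y Fy; apply: eU.
  rewrite mx_norm_ball /ball_ /=.
  rewrite (_ : x - y = (x - map_mx ratr (\row_i q i)) - (y - map_mx ratr (\row_i q i))).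
    by rewrite (le_lt_trans (ler_normB _ _))//; move: Fx Fy; rewrite /F /=; move: (k.+1%:R^-1) ke => d; lra.
  by rewrite opprB addrA subrK.
apply: countable_bigcupT_measurable => // z.
by case: ifPn => // _; apply: measurable_closed_ball_rV; rewrite invr_ge0.
Qed.

Lemma continuous_measurable_rV n (f : 'rV[R]_n -> R) :
  continuous f -> measurable_fun [set: 'rV[R]_n] f.
Proof.
move=> /continuousP cf; apply: (measurability _ (RGenOpens.measurableE R)).
move=> _ [_ [a [b ->] <-]]; rewrite setTI.
by apply: open_measurable_rV; apply: cf; exact: interval_open.
Qed.

Lemma integrable_bounded_support n (f : 'rV[R]_n -> R) (M L : R) :
  measurable_fun [set: 'rV[R]_n] f -> (forall x, `|f x| <= M) ->
  (forall x, L < `|x| -> f x = 0) -> (mu n).-integrable [set: 'rV[R]_n] (EFin \o f).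
Proof.
move=> mf fM fL.
have L0 : 0 <= `|L| by [].
(* The absolute value of L, since nothing forces L to be non-negative. *)
pose B := [set x : 'rV[R]_n | `|x - 0| <= `|L|].
have mB : measurable B by exact: measurable_closed_ball_rV.
apply: (@dominated_integrable _ _ _ _ _ (fun x => M * \1_B x)) => //.
  apply: (@integrableZl _ _ _ _ _ measurableT M (EFin \o \1_B)).
  apply: integrable_indic_lty => //.
  have : (mu n B < +oo)%E by rewrite (lebesgue_closed_ball_rV _ L0) ltry.
  exact.
move=> x; rewrite indicE; case: (asboolP (B x)) => [Bx|nBx].
  by rewrite mem_set// mulr1.
rewrite memNset// mulr0 fL ?normr0//.
move: nBx; rewrite /B /= subr0 => /negP; rewrite -ltNge.
by apply: le_lt_trans; rewrite ler_norm.
Qed.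

End rV_measure.

(** * Bessel's inequality *)

Section fejer.
Context {R : realType}.
Local Notation leb := (@lebesgue_measure R).

Lemma integral_oneDsqrV : (\int[leb]_x ((oneDsqr x)^-1)%:E = (pi : R)%:E)%E.
Proof.
rewrite (ge0_symfun_integralT (f := fun x : R => (oneDsqr x)^-1)); last 3 first.
- by move=> x; rewrite invr_ge0.
- exact: continuous_oneDsqrV.
- by move=> x; rewrite /= /oneDsqr sqrrN.
rewrite -set_itvcy integral0y_oneDsqr -EFinM; congr EFin.
by rewrite mulrC divfK.
Qed.

(** The mass is independent of N and of x, which makes the Schur test in [bessel_window] uniform in
    N. *)
Lemma integral_scaled_oneDsqrV (N x : R) : 0 < N ->
  (\int[leb]_y (N / oneDsqr (N * (y - x)))%:E = (pi : R)%:E)%E.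
Proof.
move=> N0; rewrite -integral_oneDsqrV.
pose F (y : R) := N * (y - x).
have dF (y : R) : is_derive y 1 F N.
  rewrite /F; apply: is_derive_eq; rewrite /GRing.scale /=. ring.
have dFE : F^`()%classic = cst N by apply/funext => y; rewrite derive1E derive_val.
rewrite [RHS](@increasing_ge0_integration_by_substitutionT _ F); last 9 first.
- by move=> u v uv; rewrite /F ltr_pM2l// ltrD2r.
- by rewrite dFE; exact: cst_continuous.
- by rewrite dFE; exact: is_cvg_cst.
- by rewrite dFE; exact: is_cvg_cst.
- by move=> y; exact: ex_derive.
- apply/cvgrNyPle => A; near=> y.
  rewrite /F -ler_pdivlMl// lerBlDr; near: y; by apply: nbhs_ninfty_le; rewrite num_real.
- apply/cvgryPge => A; near=> y.
  rewrite /F -ler_pdivrMl// lerBrDr; near: y; by apply: nbhs_pinfty_ge; rewrite num_real.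
- exact: continuous_oneDsqrV.
- by move=> y; rewrite invr_ge0.
by apply: eq_integral => y _; rewrite dFE /= mulrC.
Unshelve. all: by end_near. Qed.

Variable N : R.
Hypothesis N0 : 0 < N.

(** A Riesz (Welch) window, parabolic rather than the tent of the classical Fejer kernel. It
    vanishes continuously at the endpoints, so its transform decays like 1/z^2 and is integrable,
    whereas a sharp cutoff gives only 1/z. *)
Definition fejer_weight (s : R) : R := Num.max 0 (1 - (s / N) ^+ 2).

(** Repeated integration by parts: with q(t) = 1 - (t/N)^2 the primitive is q sin(zt)/z + q'
    cos(zt)/z^2 - q'' sin(zt)/z^3, and q''' = 0. *)
Lemma is_derive_fejer_primitive (z s : R) : z != 0 ->
  is_derive s (1 : R) (fun t => (1 - (t / N) ^+ 2) * (sin (z * t) / z)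
     - (2 * t / N ^+ 2) * (cos (z * t) / z ^+ 2)
     + (2 / N ^+ 2) * (sin (z * t) / z ^+ 3))
   ((1 - (s / N) ^+ 2) * cos (z * s)).
Proof.
move=> z0.
have Dl : is_derive s (1:R) ( *%R z) z.
  apply: is_derive_eq; rewrite /GRing.scale /=. ring.
have Ds : is_derive s (1 : R) (fun t => sin (z * t)) (z * cos (z * s)).
  rewrite mulrC; exact: (@is_derive1_comp _ sin ( *%R z)).
have Dc : is_derive s (1 : R) (fun t => cos (z * t)) (- (z * sin (z * s))).
  rewrite mulrC -mulNr; exact: (@is_derive1_comp _ cos ( *%R z)).
apply: is_derive_eq; rewrite /GRing.scale /=; field.
by rewrite z0 gt_eqF.
Qed.

Lemma fejer_weight_ge0 s : 0 <= fejer_weight s.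
Proof. by rewrite /fejer_weight le_max lexx. Qed.

Lemma fejer_weightE s : fejer_weight s = (1 - (s / N) ^+ 2) * \1_(`[- N, N]) s.
Proof.
rewrite /fejer_weight indicE.
have sN : ((s / N) ^+ 2 <= 1) = (- N <= s <= N).
  rewrite -[X in X <= 1]real_normK ?num_real// expr_le1// normrM normfV.
  by rewrite (gtr0_norm N0) ler_pdivrMr// mul1r ler_norml.
rewrite mem_setE in_itv /= -sN; case: lerP => h.
  by rewrite mulr1 max_r// subr_ge0.
by rewrite mulr0 max_l// subr_le0 ltW.
Qed.

Lemma fejer_weight_le s : fejer_weight s <= \1_(`[- N, N]) s.
Proof.
rewrite fejer_weightE ler_piMl// ?indicE// gerBl; exact: sqr_ge0.
Qed.

(** On the inner half the weight is at least 3/4; the cruder bound 1/2 is enough. *)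
Lemma fejer_weight_half s : `|s| <= N / 2 -> 1 <= 2 * fejer_weight s.
Proof.
move=> sN; suff : (s / N) ^+ 2 <= (1 / 2) ^+ 2.
  move=> h; have : 1 - (s / N) ^+ 2 <= fejer_weight s.
    by rewrite /fejer_weight le_max lexx orbT.
  by move: h; lra.
rewrite -[X in X <= _]real_normK ?num_real// lerXn2r ?nnegrE//.
by rewrite normrM normfV (gtr0_norm N0) ler_pdivrMr//; move: sN; lra.
Qed.

Lemma measurable_fejer_weight : measurable_fun [set: R] fejer_weight.
Proof.
apply: measurable_maxr => //.
by apply: measurable_funB => //; apply: measurable_funX; apply: measurable_funM.
Qed.

Lemma integrable_fejer_weight : leb.-integrable [set: R] (EFin \o fejer_weight).
Proof.
apply: (@dominated_integrable _ _ _ leb _ (\1_(`[- N, N]))).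
- exact: measurable_fejer_weight.
- exact: integrable_indic_itv.
- by move=> s; rewrite ger0_norm ?fejer_weight_ge0// fejer_weight_le.
Qed.

Definition fejer_kernel (z : R) : R := \int[leb]_s (fejer_weight s * cos (z * s)).

(** The 1/z term of the primitive carries the factor q, which vanishes at both endpoints; only
    orders 1/z^2 and 1/z^3 survive. *)
Lemma fejer_kernelE z : z != 0 -> fejer_kernel z =
  4 * sin (z * N) / (N ^+ 2 * z ^+ 3) - 4 * cos (z * N) / (N * z ^+ 2).
Proof.
move=> z0.
have NN : - N < N by rewrite gtrN.
pose f s := (1 - (s / N) ^+ 2) * cos (z * s).
transitivity (\int[leb]_(s in `[- N, N]) f s).
  rewrite Rintegral_mkcond; apply: eq_Rintegral => s _.
  rewrite fejer_weightE patchE indicE /f; case: ifPn => _; rewrite ?mulr1//.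
  by rewrite mulr0 mul0r.
rewrite /Rintegral.
have cf : continuous f.
  move=> s; apply: cvgM.
    apply: cvgB; first exact: cvg_cst.
    by apply: cvgM; (apply: cvgM; [exact: cvg_id|exact: cvg_cst]).
  apply: (continuous_comp (f := fun t => z * t)); last exact: continuous_cos.
  by apply: cvgM; [exact: cvg_cst|exact: cvg_id].
pose G t := (1 - (t / N) ^+ 2) * (sin (z * t) / z)
     - (2 * t / N ^+ 2) * (cos (z * t) / z ^+ 2)
     + (2 / N ^+ 2) * (sin (z * t) / z ^+ 3).
have dG s : is_derive s (1 : R) G (f s) by exact: is_derive_fejer_primitive.
have cG : continuous G.
  move=> s; apply: differentiable_continuous; apply/derivable1_diffP.
  exact: ex_derive.
rewrite (@continuous_FTC2 _ f G)//.
- rewrite /= /G mulrN sinN cosN; field.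
  by rewrite z0 gt_eqF.
- exact: continuous_subspaceT.
- split.
  + by move=> s _; exact: ex_derive.
  + by apply: cvg_at_right_filter; exact: cG.
  + by apply: cvg_at_left_filter; exact: cG.
- by move=> s _; rewrite derive1E derive_val.
Qed.

Let mwc z : measurable_fun [set: R] (fun s => fejer_weight s * cos (z * s)).
Proof.
apply: measurable_funM; first exact: measurable_fejer_weight.
apply: (measurableT_comp (f := @cos R)); last exact: measurable_funM.
by apply: continuous_measurable_fun; exact: continuous_cos.
Qed.

Let iwc z : leb.-integrable [set: R] (EFin \o (fun s => fejer_weight s * cos (z * s))).
Proof.
apply: (@dominated_integrable _ _ _ leb _ fejer_weight); first exact: mwc.
  exact: integrable_fejer_weight.
move=> s; rewrite normrM ger0_norm ?fejer_weight_ge0//.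
by rewrite ler_piMr ?fejer_weight_ge0// ler_norml cos_geN1 cos_le1.
Qed.

(** For |Nz| <= 1 the bound 2N by the length of the window suffices. Beyond, the explicit formula
    gives 8N/(Nz)^2, and 1 + (Nz)^2 <= 2 (Nz)^2 turns the 8 into 16. *)
Lemma fejer_kernel_le z : `|fejer_kernel z| <= 16 * (N / oneDsqr (N * z)).
Proof.
have := oneDsqr_ge1 (N * z); rewrite /oneDsqr => ge1.
have [Nz|Nz] := leP `|N * z| 1.
  apply: (@le_trans _ _ (2 * N)).
    rewrite (le_trans (le_normr_Rintegral _ _))//.
    apply: (@le_trans _ _ (\int[leb]_s \1_(`[- N, N]) s)).
      apply: le_Rintegral => //.
      - by apply: integrable_norm; exact: iwc.
      - exact: integrable_indic_itv.
      - move=> s _; rewrite normrM ger0_norm ?fejer_weight_ge0//.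
        rewrite (le_trans _ (fejer_weight_le s))// ler_piMr ?fejer_weight_ge0//.
        by rewrite ler_norml cos_geN1 cos_le1.
    have E : lebesgue_measure (`[- N, N]%classic : set R) = (N + N)%:E.
      by rewrite lebesgue_measure_itv /= lte_fin gtrN// -EFinB opprK.
    rewrite /Rintegral [X in fine X](_ : _ = (N + N)%:E) /=.
      by rewrite mulr_natl mulr2n.
    by rewrite -E integral_indic// setIT.
  rewrite mulrA ler_pdivlMr; last exact: lt_le_trans ge1.
  have : (N * z) ^+ 2 <= 1 by rewrite -real_normK ?num_real// expr_le1.
  by have N0' : 0 < N := N0; move: ((N * z) ^+ 2) ge1 => t t0 t1; nra.
have z0 : z != 0 by apply: contraTneq Nz => ->; rewrite mulr0 normr0 ltr10.
have -> : fejer_kernel z =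
    4 * N * (sin (z * N) / (N * z) ^+ 3 - cos (z * N) / (N * z) ^+ 2).
  rewrite fejer_kernelE//; field; by rewrite z0 gt_eqF.
rewrite normrM (@gtr0_norm _ (4 * N)) ?mulr_gt0//.
have t0 : 0 < `|N * z| by exact: lt_trans Nz.
have t2 : 1 <= (N * z) ^+ 2 by rewrite -real_normK ?num_real// exprn_ege1// ltW.
have t2p := lt_le_trans ltr01 t2.
have h : `|sin (z * N) / (N * z) ^+ 3 - cos (z * N) / (N * z) ^+ 2| <= 2 / (N * z) ^+ 2.
  rewrite (le_trans (ler_normB _ _))// mulr_natl mulr2n lerD//.
    rewrite normrM normfV normrX exprS [X in _ / (_ * X)]real_normK ?num_real//.
    rewrite (ler_pdivrMr _ _ (mulr_gt0 t0 t2p)).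
    rewrite mulrCA mulVf ?mulr1; last by rewrite gt_eqF.
    by rewrite (le_trans _ (ltW Nz))// ler_norml sin_geN1 sin_le1.
  rewrite normrM normfV normrX real_normK ?num_real//.
  rewrite (ler_pdivrMr _ _ t2p) mulVf ?gt_eqF//.
  by rewrite ler_norml cos_geN1 cos_le1.
rewrite (le_trans (ler_wpM2l _ h)) ?mulr_ge0// ?(ltW N0)//.
move: ((N * z) ^+ 2) t2 {h t2p} => t t2.
rewrite !mulrA ler_pdivrMr; last by lra.
rewrite [leRHS]mulrAC ler_pdivlMr; last by lra.
by have N0' : 0 < N := N0; nra.
Qed.

End fejer.

Section real_integrals.
Context d (T : measurableType d) (R : realType).

Lemma measurable_cos_comp (f : T -> R) :
  measurable_fun [set: T] f -> measurable_fun [set: T] (fun x => cos (f x)).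
Proof.
move=> mf; apply: (measurableT_comp (f := @cos R)) => //.
by apply: continuous_measurable_fun; exact: continuous_cos.
Qed.

Lemma measurable_sin_comp (f : T -> R) :
  measurable_fun [set: T] f -> measurable_fun [set: T] (fun x => sin (f x)).
Proof.
move=> mf; apply: (measurableT_comp (f := @sin R)) => //.
by apply: continuous_measurable_fun; exact: continuous_sin.
Qed.

Variable m : {sigma_finite_measure set T -> \bar R}.

(** If the extended integral is infinite, the left side is 0 by the default value of [fine]. *)
Lemma le_normr_Rintegral_ereal (f : T -> R) : measurable_fun [set: T] f ->
  (`|\int[m]_x f x|%:E <= \int[m]_x `|f x|%:E)%E.
Proof.
move=> mf; have mE : measurable_fun [set: T] (EFin \o f) by exact/measurable_EFinP.
apply: (le_trans _ (le_abse_integral m measurableT mE)).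
rewrite /Rintegral; case: (\int[m]_x (EFin \o f) x)%E => //=.
  by rewrite normr0 leey.
by rewrite normr0 leey.
Qed.

Lemma integrableM_cos (u f : T -> R) : measurable_fun [set: T] f ->
  m.-integrable [set: T] (EFin \o u) ->
  m.-integrable [set: T] (EFin \o (fun x => u x * cos (f x))).
Proof.
move=> mf iu; apply: (@dominated_integrable _ _ _ _ _ (fun x => `|u x|)).
- apply: measurable_funM; last exact: measurable_cos_comp.
  by apply/measurable_EFinP; case/integrableP: iu.
- exact: (integrable_norm iu).
- by move=> x; rewrite normrM ler_piMr// ler_norml cos_geN1 cos_le1.
Qed.

Lemma integrableM_sin (u f : T -> R) : measurable_fun [set: T] f ->
  m.-integrable [set: T] (EFin \o u) ->
  m.-integrable [set: T] (EFin \o (fun x => u x * sin (f x))).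
Proof.
move=> mf iu; apply: (@dominated_integrable _ _ _ _ _ (fun x => `|u x|)).
- apply: measurable_funM; last exact: measurable_sin_comp.
  by apply/measurable_EFinP; case/integrableP: iu.
- exact: (integrable_norm iu).
- by move=> x; rewrite normrM ler_piMr// ler_norml sin_geN1 sin_le1.
Qed.

Lemma normr_Rintegral_dominated (f a : T -> R) : measurable_fun [set: T] f ->
  m.-integrable [set: T] (EFin \o a) -> (forall x, `|f x| <= a x) ->
  `|\int[m]_x f x| <= \int[m]_x a x.
Proof.
move=> mf ia fa; have ja := dominated_integrable mf ia fa.
apply: (le_trans (le_normr_Rintegral measurableT ja)).
by apply: le_Rintegral => //; exact: (integrable_norm ja).
Qed.

End real_integrals.

(** * Bessel's inequality on the line *)

Section bessel_real_line.
Context {R : realType}.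
Local Notation leb := (@lebesgue_measure R).
Variable u : R -> R.
Hypothesis mu : measurable_fun [set: R] u.
Hypothesis iu : leb.-integrable [set: R] (EFin \o u).

Local Notation C s := (\int[leb]_x (u x * cos (x * s))).
Local Notation S s := (\int[leb]_x (u x * sin (x * s))).
Let U := \int[leb]_x `|u x|.

Let iC s : leb.-integrable [set: R] (EFin \o (fun x => u x * cos (x * s))).
Proof. by apply: integrableM_cos => //; exact: measurable_funM. Qed.

Let iS s : leb.-integrable [set: R] (EFin \o (fun x => u x * sin (x * s))).
Proof. by apply: integrableM_sin => //; exact: measurable_funM. Qed.

Let inu : leb.-integrable [set: R] (EFin \o (fun x => `|u x|)).
Proof. exact: (integrable_norm iu). Qed.

Let mC : measurable_fun [set: R] (fun s => C s).
Proof.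
apply: (@measurable_param_Rintegral _ _ R (measurableTypeR R) R leb (fun s x => u x * cos (x * s))).
apply: measurable_funM; first exact: measurableT_comp.
by apply: measurable_cos_comp; exact: measurable_funM.
Qed.

Let mS : measurable_fun [set: R] (fun s => S s).
Proof.
apply: (@measurable_param_Rintegral _ _ R (measurableTypeR R) R leb (fun s x => u x * sin (x * s))).
apply: measurable_funM; first exact: measurableT_comp.
by apply: measurable_sin_comp; exact: measurable_funM.
Qed.

(** The integrand of |u^(s)|^2 written as a double integral; integrating it in s against the window
    produces the kernel [K (x - y)]. *)
Let Q x y s := u x * u y * cos ((x - y) * s).

Let sumQ x s : \int[leb]_y Q x y s = u x * cos (x * s) * C s + u x * sin (x * s) * S s.
Proof.
rewrite -!RintegralZl// -RintegralD//; last 2 first.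
- exact: (integrableZl measurableT (u x * cos (x * s)) (iC s)).
- exact: (integrableZl measurableT (u x * sin (x * s)) (iS s)).
apply: eq_Rintegral => y _.
by rewrite /Q mulrBl cosB; ring.
Qed.

Let sumsumQ s : \int[leb]_x (\int[leb]_y Q x y s) = C s ^+ 2 + S s ^+ 2.
Proof.
transitivity (\int[leb]_x (u x * cos (x * s) * C s + u x * sin (x * s) * S s)).
  by apply: eq_Rintegral => x _; exact: sumQ.
rewrite RintegralD// ?RintegralZr// ?expr2//.
- exact: (integrableZr measurableT (C s) (iC s)).
- exact: (integrableZr measurableT (S s) (iS s)).
Qed.

Let mQ2 (d : measure_display) (T : measurableType d) (f g h : T -> R) :
  measurable_fun [set: T] f -> measurable_fun [set: T] g ->
  measurable_fun [set: T] h -> measurable_fun [set: T] (fun z => Q (f z) (g z) (h z)).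
Proof.
move=> mf mg mh; apply: measurable_funM; last first.
  by apply: measurable_cos_comp; apply: measurable_funM => //; exact: measurable_funB.
by apply: measurable_funM; exact: measurableT_comp.
Qed.

Let Qle x y s : `|Q x y s| <= `|u x| * `|u y|.
Proof. by rewrite /Q normrM normrM ler_piMr// ler_norml cos_geN1 cos_le1. Qed.

Section window.
Variable N : R.
Hypothesis N0 : 0 < N.
Local Notation w := (fejer_weight N).
Local Notation K := (fejer_kernel N).

Let iw : leb.-integrable [set: R] (EFin \o w). Proof. exact: integrable_fejer_weight. Qed.
Let mw : measurable_fun [set: R] w. Proof. exact: measurable_fejer_weight. Qed.
Let w0 s : 0 <= w s. Proof. exact: fejer_weight_ge0. Qed.

Let mK : measurable_fun [set: R] K.
Proof.
apply: (@measurable_param_Rintegral _ _ R (measurableTypeR R) R leb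
  (fun z s => w s * cos (z * s))).
apply: measurable_funM; first exact: measurableT_comp.
by apply: measurable_cos_comp; exact: measurable_funM.
Qed.

Let intQ x s : `|\int[leb]_y Q x y s| <= `|u x| * U.
Proof.
rewrite -RintegralZl//; apply: (@normr_Rintegral_dominated _ _ _ leb).
- exact: (@mQ2 _ R).
- exact: (integrableZl measurableT _ inu).
- by move=> y; exact: Qle.
Qed.

Let sumQw x y : \int[leb]_s (w s * Q x y s) = u x * u y * K (x - y).
Proof.
rewrite -RintegralZl//; last first.
  apply: (@dominated_integrable _ _ _ leb _ w) => //.
    by apply: measurable_funM => //; apply: measurable_cos_comp; exact: measurable_funM.
  move=> s; rewrite normrM ger0_norm//.
  by rewrite ler_piMr// ler_norml cos_geN1 cos_le1.
by apply: eq_Rintegral => s _; rewrite /Q mulrCA.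
Qed.

(** The integral in s moves past x and past y in two separate exchanges, dominated by products of w,
    |u(x)| and |u(y)|. The window is what makes the s-integral absolutely convergent. *)
Let swapQ : \int[leb]_s (w s * (C s ^+ 2 + S s ^+ 2)) =
  \int[leb]_x (\int[leb]_y (u x * u y * K (x - y))).
Proof.
transitivity (\int[leb]_s \int[leb]_x (w s * \int[leb]_y Q x y s)).
  apply: eq_Rintegral => s _; rewrite RintegralZl ?sumsumQ//.
  apply: (@dominated_integrable _ _ _ leb _ (fun x => `|u x| * U)).
  - apply: (@measurable_param_Rintegral _ _ R (measurableTypeR R) R leb
      (fun x y => Q x y s)).
    by apply: (@mQ2 _ (R * measurableTypeR R)%type).
  - exact: (integrableZr measurableT _ inu).
  - by move=> x; exact: intQ.
transitivity (\int[leb]_x \int[leb]_s (w s * \int[leb]_y Q x y s)).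
  apply: (@Rintegral_swap _ _ (measurableTypeR R) (measurableTypeR R) R leb leb
    (fun s x => w s * \int[leb]_y Q x y s) w (fun x => `|u x| * U)).
  - apply: measurable_funM; first exact: (measurableT_comp mw measurable_fst).
    apply: (@measurable_param_Rintegral _ _ (measurableTypeR R * measurableTypeR R)%type
      (measurableTypeR R) R leb (fun z y => Q z.2 y z.1)).
    apply: mQ2.
    + exact: (measurableT_comp measurable_snd measurable_fst).
    + exact: measurable_snd.
    + exact: (measurableT_comp measurable_fst measurable_fst).
  - exact: iw.
  - exact: (integrableZr measurableT _ inu).
  - by move=> s x; rewrite normrM ger0_norm// ler_wpM2l.
apply: eq_Rintegral => x _.
transitivity (\int[leb]_s (\int[leb]_y (w s * Q x y s))).
  apply: eq_Rintegral => s _; rewrite RintegralZl//.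
  apply: (@dominated_integrable _ _ _ leb _ (fun y => `|u x| * `|u y|)).
  - exact: (@mQ2 _ R).
  - exact: (integrableZl measurableT _ inu).
  - by move=> y; exact: Qle.
transitivity (\int[leb]_y \int[leb]_s (w s * Q x y s)).
  apply: (@Rintegral_swap _ _ (measurableTypeR R) (measurableTypeR R) R leb leb
    (fun s y => w s * Q x y s) w (fun y => `|u x| * `|u y|)).
  - apply: measurable_funM; first exact: (measurableT_comp mw measurable_fst).
    apply: mQ2; [exact: measurable_cst|exact: measurable_snd|exact: measurable_fst].
  - exact: iw.
  - exact: (integrableZl measurableT _ inu).
  - by move=> s y; rewrite normrM ger0_norm// ler_wpM2l.
by apply: eq_Rintegral => y _; exact: sumQw.
Qed.

Let k x y : R := N / oneDsqr (N * (y - x)).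

Let kC x y : k x y = k y x.
Proof. by rewrite /k /oneDsqr -[y - x]opprB mulrN sqrrN. Qed.

Let k0 x y : 0 <= k x y.
Proof. by rewrite /k divr_ge0// ?(ltW N0)// (le_trans ler01)// oneDsqr_ge1. Qed.

Let mk (d : measure_display) (T : measurableType d) (f g : T -> R) :
  measurable_fun [set: T] f -> measurable_fun [set: T] g ->
  measurable_fun [set: T] (fun z => k (f z) (g z)).
Proof.
move=> mf mg; apply: measurable_funM => //.
apply: (measurableT_comp (f := fun z : R => (oneDsqr z)^-1)).
  by apply: continuous_measurable_fun; exact: continuous_oneDsqrV.
by apply: measurable_funM => //; exact: measurable_funB.
Qed.

(** Schur's test: 2ab <= a^2 + b^2 separates u(x) from u(y), so that in each half the kernel can be
    integrated out over the other variable, with mass pi. *)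
Let uuK x y : `|u x * u y * K (x - y)| <= 8 * (u x ^+ 2 * k x y) + 8 * (u y ^+ 2 * k x y).
Proof.
rewrite normrM normrM; have := fejer_kernel_le N0 (x - y).
rewrite -/(k y x) kC => h.
apply: (@le_trans _ _ (`|u x| * `|u y| * (16 * k x y))).
  by rewrite ler_wpM2l// mulr_ge0.
rewrite -(real_normK (num_real (u x))) -(real_normK (num_real (u y))).
have := k0 x y; have := sqr_ge0 (`|u x| - `|u y|).
move: (k x y) (`|u x|) (`|u y|) => c a b ab c0.
have := mulr_ge0 ab c0; nra.
Qed.

Let B := (\int[leb]_x (u x ^+ 2)%:E)%E.

Let int_uk : (\int[leb]_x \int[leb]_y (8 * (u x ^+ 2 * k x y))%:E = (8 * pi)%:E * B)%E.
Proof.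
have e x y : (8 * (u x ^+ 2 * k x y))%:E = ((8 * u x ^+ 2)%:E * (k x y)%:E)%E.
  by rewrite -EFinM mulrA.
under eq_integral => x _.
  under eq_integral do rewrite e.
  rewrite ge0_integralZl//; last 3 first.
  - by apply/measurable_EFinP; exact: (@mk _ R).
  - by move=> y _; rewrite lee_fin.
  - by rewrite lee_fin mulr_ge0// sqr_ge0.
  rewrite integral_scaled_oneDsqrV// -EFinM mulrAC EFinM.
  over.
rewrite ge0_integralZl//.
- by apply/measurable_EFinP; exact: measurable_funX.
- by move=> x _; rewrite lee_fin sqr_ge0.
- by rewrite lee_fin mulr_ge0// pi_ge0.
Qed.

Let int_uk' : (\int[leb]_x \int[leb]_y (8 * (u y ^+ 2 * k x y))%:E = (8 * pi)%:E * B)%E.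
Proof.
rewrite -int_uk.
rewrite (@fubini_tonelli _ _ (measurableTypeR R) (measurableTypeR R) R leb leb
  (fun z => (8 * (u z.2 ^+ 2 * k z.1 z.2))%:E)).
- by apply: eq_integral => y _; apply: eq_integral => x _ /=; rewrite kC.
- apply/measurable_EFinP; apply: measurable_funM => //.
  apply: measurable_funM; first by apply: measurable_funX; exact: measurableT_comp.
  exact: mk.
- by move=> z; rewrite lee_fin mulr_ge0// mulr_ge0// sqr_ge0.
Qed.

(** The constant is 8 pi + 8 pi, one summand for each half of [uuK]. N does not appear on the right,
    and [B] may be infinite, u being only integrable. *)
Lemma bessel_window :
  (\int[leb]_s (w s * (C s ^+ 2 + S s ^+ 2))%:E <= (16 * pi)%:E * B)%E.
Proof.
have CS0 s : 0 <= C s ^+ 2 + S s ^+ 2 by rewrite addr_ge0// sqr_ge0.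
have CU s : `|C s| <= U.
  apply: (@normr_Rintegral_dominated _ _ _ leb) => //.
    by apply: measurable_funM => //; apply: measurable_cos_comp; exact: measurable_funM.
  by move=> x; rewrite normrM ler_piMr// ler_norml cos_geN1 cos_le1.
have SU s : `|S s| <= U.
  apply: (@normr_Rintegral_dominated _ _ _ leb) => //.
    by apply: measurable_funM => //; apply: measurable_sin_comp; exact: measurable_funM.
  by move=> x; rewrite normrM ler_piMr// ler_norml sin_geN1 sin_le1.
have mCS : measurable_fun [set: R] (fun s => C s ^+ 2 + S s ^+ 2).
  by apply: measurable_funD; apply: measurable_funX.
have U0 : 0 <= U by apply: le_trans (CU 0).
have <- : (\int[leb]_s (w s * (C s ^+ 2 + S s ^+ 2)))%:E =
    (\int[leb]_s (w s * (C s ^+ 2 + S s ^+ 2))%:E)%E.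
  apply: fineK; apply: integrable_fin_num => //.
  apply: (@dominated_integrable _ _ _ leb _ (fun s => w s * (U ^+ 2 + U ^+ 2))).
  - exact: measurable_funM.
  - exact: (integrableZr measurableT _ iw).
  - move=> s; rewrite normrM ger0_norm// ler_wpM2l// ger0_norm//.
    by apply: lerD; rewrite -[leLHS]real_normK ?num_real// lerXn2r ?nnegrE.
rewrite swapQ.
have muuK : measurable_fun [set: R * R] (fun z : R * R => u z.1 * u z.2 * K (z.1 - z.2)).
  apply: measurable_funM; first by apply: measurable_funM; exact: measurableT_comp.
  by apply: measurableT_comp => //; exact: measurable_funB.
apply: (@le_trans _ _ (\int[leb]_x (`|\int[leb]_y (u x * u y * K (x - y))|)%:E)%E).
  apply: (le_trans _ (le_normr_Rintegral_ereal leb _)); first by rewrite lee_fin ler_norm.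
  by apply: (@measurable_param_Rintegral _ _ R (measurableTypeR R) R leb
     (fun x y => u x * u y * K (x - y))).
have ms x : measurable_fun [set: R] (fun y => u x * u y * K (x - y)).
  by apply: measurable_funM; [exact: measurable_funM|apply: measurableT_comp => //; exact: measurable_funB].
have hk1 x : measurable_fun [set: R] (fun y => 8 * (u x ^+ 2 * k x y)).
  by apply: measurable_funM => //; apply: measurable_funM => //; exact: (@mk _ R).
have hk2 x : measurable_fun [set: R] (fun y => 8 * (u y ^+ 2 * k x y)).
  by apply: measurable_funM => //; apply: measurable_funM; [exact: measurable_funX|exact: (@mk _ R)].
have m1 : measurable_fun [set: R] (fun x => \int[leb]_y (8 * (u x ^+ 2 * k x y))%:E)%E.
  apply: (@measurable_param_ge0_integral _ _ R (measurableTypeR R) R leb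
      (fun x y => (8 * (u x ^+ 2 * k x y))%:E)).
    apply/measurable_EFinP; apply: measurable_funM => //; apply: measurable_funM; last exact: mk.
    by apply: measurable_funX; exact: measurableT_comp.
  by move=> x y; rewrite lee_fin mulr_ge0// mulr_ge0// sqr_ge0.
have m2 : measurable_fun [set: R] (fun x => \int[leb]_y (8 * (u y ^+ 2 * k x y))%:E)%E.
  apply: (@measurable_param_ge0_integral _ _ R (measurableTypeR R) R leb
      (fun x y => (8 * (u y ^+ 2 * k x y))%:E)).
    apply/measurable_EFinP; apply: measurable_funM => //; apply: measurable_funM; last exact: mk.
    by apply: measurable_funX; exact: measurableT_comp.
  by move=> x y; rewrite lee_fin mulr_ge0// mulr_ge0// sqr_ge0.
apply: (@le_trans _ _ (\int[leb]_x (\int[leb]_y (8 * (u x ^+ 2 * k x y))%:E +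
     \int[leb]_y (8 * (u y ^+ 2 * k x y))%:E))%E).
  apply: ge0_le_integral => //.
  - apply/measurable_EFinP; apply: measurableT_comp => //.
    by apply: (@measurable_param_Rintegral _ _ R (measurableTypeR R) R leb
      (fun x y => u x * u y * K (x - y))).
  - exact: emeasurable_funD.
  - move=> x _; apply: (le_trans (le_normr_Rintegral_ereal leb (ms x))).
    rewrite -ge0_integralD//; last 4 first.
    - by move=> y _; rewrite lee_fin mulr_ge0// mulr_ge0// sqr_ge0.
    - by apply/measurable_EFinP; exact: hk1.
    - by move=> y _; rewrite lee_fin mulr_ge0// mulr_ge0// sqr_ge0.
    - by apply/measurable_EFinP; exact: hk2.
    apply: ge0_le_integral => //.
    - by apply/measurable_EFinP; apply: measurableT_comp => //; exact: ms.
    - by apply/measurable_EFinP; apply: measurable_funD; [exact: hk1|exact: hk2].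
    - by move=> y _; rewrite -EFinD lee_fin.
rewrite ge0_integralD//; last 2 first.
- by move=> x _; apply: integral_ge0 => y _; rewrite lee_fin mulr_ge0// mulr_ge0// sqr_ge0.
- by move=> x _; apply: integral_ge0 => y _; rewrite lee_fin mulr_ge0// mulr_ge0// sqr_ge0.
rewrite int_uk int_uk' -ge0_muleDl ?lee_fin ?mulr_ge0 ?pi_ge0// -EFinD.
by rewrite -mulrDl -natrD.
Qed.

End window.

(** Monotone exhaustion by [[-(i+1), i+1]]. On that interval twice the window of parameter 2(i+1) is
    at least 1, whence 32 = 2 * 16; Plancherel's constant would be 2 pi. *)
Lemma bessel1 : (\int[leb]_s (C s ^+ 2 + S s ^+ 2)%:E <=
  (32 * pi)%:E * \int[leb]_x (u x ^+ 2)%:E)%E.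
Proof.
have mCS : measurable_fun [set: R] (fun s => C s ^+ 2 + S s ^+ 2).
  by apply: measurable_funD; apply: measurable_funX.
have CS0 s : 0 <= C s ^+ 2 + S s ^+ 2 by rewrite addr_ge0// sqr_ge0.
pose F (i : nat) : set R := `[(- (i.+1%:R))%R, (i.+1%:R)%R]%classic.
have UF : \bigcup_i F i = [set: R].
  apply/seteqP; split => // x _; exists (Num.truncn `|x|) => //.
  rewrite /F /= in_itv /= -ler_norml ltW//.
  by have /andP[] := truncn_itv (normr_ge0 x).
have := @ge0_nondecreasing_set_cvg_integral _ (measurableTypeR R) R F
  (fun s => (C s ^+ 2 + S s ^+ 2)%:E) leb.
rewrite UF => /(_ _ _ _ _) cvgF.
have := cvge_to_le (cvgF _ _ _ _); apply.
- move=> i j ij; apply/subsetPset => x; rewrite /F /= !in_itv /= => /andP[h1 h2].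
  have : i.+1%:R <= j.+1%:R :> R by rewrite ler_nat.
  by move: h1 h2; lra.
- by move=> i; exact: measurable_itv.
- by move=> i; apply/measurable_EFinP; exact: measurable_funTS.
- by move=> i x _; rewrite lee_fin.
near=> i.
have N0 : 0 < 2 * i.+1%:R :> R by rewrite mulr_gt0.
have mwCS : measurable_fun [set: R]
    (fun s => fejer_weight (2 * i.+1%:R) s * (C s ^+ 2 + S s ^+ 2)).
  by apply: measurable_funM => //; exact: measurable_fejer_weight.
have wCS0 s : 0 <= fejer_weight (2 * i.+1%:R) s * (C s ^+ 2 + S s ^+ 2).
  by rewrite mulr_ge0// fejer_weight_ge0.
apply: (@le_trans _ _ (2%:E * \int[leb]_s
    (fejer_weight (2 * i.+1%:R) s * (C s ^+ 2 + S s ^+ 2))%:E)%E).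
  rewrite -ge0_integralZl//; last 2 first.
  - exact/measurable_EFinP.
  - by move=> s _; rewrite lee_fin.
  apply: (@le_trans _ _ (\int[leb]_(s in F i)
     (2%:E * (fejer_weight (2 * i.+1%:R) s * (C s ^+ 2 + S s ^+ 2))%:E))%E).
    apply: ge0_le_integral => //.
    - exact: measurable_itv.
    - by move=> s _; rewrite lee_fin.
    - by apply/measurable_EFinP; exact: measurable_funTS.
    - by apply/measurable_EFinP; apply: measurable_funM => //; exact: measurable_funTS.
    - move=> s; rewrite /F /= in_itv /= => h.
      rewrite -EFinM lee_fin mulrA ler_peMl// fejer_weight_half//.
      by rewrite mulrC mulKf// ler_norml.
  apply: ge0_subset_integral => //.
  - exact: measurable_itv.
  - by apply/measurable_EFinP; apply: measurable_funM.
  - by move=> s _; rewrite lee_fin mulr_ge0.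
have -> : (32 * pi)%:E = (2%:E * (16 * pi)%:E)%E :> \bar R.
  by rewrite -EFinM; congr EFin; ring.
by rewrite -muleA lee_wpmul2l ?lee_fin//; exact: bessel_window.
Unshelve. all: by end_near. Qed.

End bessel_real_line.

(** * Bessel's inequality in R^n, by induction on n *)

Section besseln.
Context {R : realType}.
Local Notation leb := (@lebesgue_measure R).
Local Notation mu n := (@lebesgue_rV R n).

(** For real f the Fourier transform is [cosT f - i sinT f]. *)
Definition cosT n (f : 'rV[R]_n -> R) (xi : 'rV[R]_n) : R :=
  \int[mu n]_x (f x * cos (dot x xi)).

Definition sinT n (f : 'rV[R]_n -> R) (xi : 'rV[R]_n) : R :=
  \int[mu n]_x (f x * sin (dot x xi)).

(** Every section of such a function is again tame, hence integrable, as the induction on the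
    dimension requires; bare integrability would pass only to almost every section. *)
Definition tame n (f : 'rV[R]_n -> R) := measurable_fun [set: 'rV[R]_n] f /\
  exists M L : R, (forall x, `|f x| <= M) /\ (forall x, L < `|x| -> f x = 0).

Lemma tame_integrable n (f : 'rV[R]_n -> R) : tame f ->
  (mu n).-integrable [set: 'rV[R]_n] (EFin \o f).
Proof. by move=> [mf [M [L [fM fL]]]]; exact: integrable_bounded_support fM fL. Qed.

Lemma consrV_lshift n (x : R) (y : 'rV[R]_n) (i : 'I_1) :
  consrV (x, y) 0 (lshift n i) = x.
Proof. by rewrite [consrV _]/(row_mx _ _) !mxE (unsplitK (inl _ i)) mxE. Qed.

Lemma consrV_rshift n (x : R) (y : 'rV[R]_n) i : consrV (x, y) 0 (rshift 1 i) = y 0 i.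
Proof. by rewrite [consrV _]/(row_mx _ _) !mxE (unsplitK (inr _ i)). Qed.

Lemma rV_norm_consrV n (x : R) (y : 'rV[R]_n) : `|x| <= `|consrV (x, y)| /\ `|y| <= `|consrV (x, y)|.
Proof.
split.
  have := rV_norm_coord (consrV (x, y)) 0.
  by rewrite !mxE; case: splitP => // j _; rewrite mxE.
apply/rV_norm_leP => // i; have := rV_norm_coord (consrV (x, y)) (rshift 1 i).
by rewrite consrV_rshift.
Qed.

Lemma dot_consrV n (x s : R) (y e : 'rV[R]_n) :
  dot (consrV (x, y)) (consrV (s, e)) = x * s + dot y e.
Proof.
rewrite /dot [LHS](@big_split_ord _ _ _ 1 n) big_ord1; congr (_ + _).
  by rewrite !consrV_lshift.
apply: eq_bigr => i _.
by rewrite !consrV_rshift.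
Qed.

(** Sup-norm balls are products, so the indicator of one containing the support splits into the two
    factors demanded by [Rintegral_lebesgue_rVS]. *)
Lemma tame_consrV_dominated n (f : 'rV[R]_n.+1 -> R) : tame f ->
  exists (a : R -> R) (b : 'rV[R]_n -> R),
    [/\ leb.-integrable [set: R] (EFin \o a),
        (mu n).-integrable [set: 'rV[R]_n] (EFin \o b),
        (forall y, 0 <= b y) &
        forall x y, `|f (consrV (x, y))| <= a x * b y].
Proof.
move=> [mf [M [L [fM fL]]]].
have mB : measurable [set x : 'rV[R]_n | `|x - 0| <= `|L|].
  exact: measurable_closed_ball_rV.
exists (fun x => M * \1_(`[- `|L|, `|L|]) x), (\1_[set x : 'rV[R]_n | `|x - 0| <= `|L|]).
split.
- exact: (integrableZl measurableT M (integrable_indic_itv (- `|L|) `|L| true false)).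
- apply: integrable_indic_lty => //.
  have : (mu n [set x : 'rV[R]_n | (`|x - 0| <= `|L|)%R] < +oo)%E.
    by rewrite (lebesgue_closed_ball_rV _ (normr_ge0 L)) ltry.
  exact.
- by move=> y; rewrite indicE.
- move=> x y; have [h1 h2] := rV_norm_consrV x y.
  have [xyL|Lxy] := lerP `|consrV (x, y)| `|L|.
    rewrite !indicE !mem_set /=.
    + by rewrite !mulr1.
    + by rewrite subr0 (le_trans h2).
    + by rewrite in_itv /= -ler_norml (le_trans h1).
  rewrite fL ?normr0; last by rewrite (le_lt_trans (ler_norm _) Lxy).
  by rewrite mulr_ge0// ?indicE// mulr_ge0// (le_trans _ (fM 0)).
Qed.

Lemma tame_section n (f : 'rV[R]_n.+1 -> R) x : tame f ->
  tame (fun y => f (consrV (x, y))).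
Proof.
move=> [mf [M [L [fM fL]]]]; split.
  have : measurable_fun [set: measurableTypeR R * 'rV[R]_n] (f \o @consrV R n).
    by apply: measurableT_comp => //; exact: measurable_consrV.
  exact: measurable_fun_pair2.
exists M, L; split => // y Ly; apply: fL.
by rewrite (lt_le_trans Ly)//; have [] := rV_norm_consrV x y.
Qed.

Lemma measurable_cosT d (T : measurableType d) n (f : T -> 'rV[R]_n -> R)
    (g : T -> 'rV[R]_n) :
  measurable_fun [set: T * 'rV[R]_n] (fun z => f z.1 z.2) ->
  measurable_fun [set: T] g -> measurable_fun [set: T] (fun z => cosT (f z) (g z)).
Proof.
move=> mf mg; apply: (measurable_param_Rintegral (mu n) (F := fun z x => f z x * cos (dot x (g z)))).
apply: measurable_funM => //; apply: measurable_cos_comp.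
by apply: measurable_dot => //; exact: measurableT_comp.
Qed.

Lemma measurable_sinT d (T : measurableType d) n (f : T -> 'rV[R]_n -> R)
    (g : T -> 'rV[R]_n) :
  measurable_fun [set: T * 'rV[R]_n] (fun z => f z.1 z.2) ->
  measurable_fun [set: T] g -> measurable_fun [set: T] (fun z => sinT (f z) (g z)).
Proof.
move=> mf mg; apply: (measurable_param_Rintegral (mu n) (F := fun z x => f z x * sin (dot x (g z)))).
apply: measurable_funM => //; apply: measurable_sin_comp.
by apply: measurable_dot => //; exact: measurableT_comp.
Qed.

Section step.
Variables (n : nat) (f : 'rV[R]_n.+1 -> R).
Hypothesis tf : tame f.

Local Notation Gc e := (fun x => cosT (fun y => f (consrV (x, y))) e).
Local Notation Gs e := (fun x => sinT (fun y => f (consrV (x, y))) e).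

Let mf : measurable_fun [set: 'rV[R]_n.+1] f. Proof. by case: tf. Qed.

Let mfc : measurable_fun [set: measurableTypeR R * 'rV[R]_n] (fun z => f (consrV (z.1, z.2))).
Proof.
rewrite (_ : (fun z => _) = f \o @consrV R n); last by apply/funext => -[].
by apply: measurableT_comp => //; exact: measurable_consrV.
Qed.

Let mp : measurable_fun [set: measurableTypeR R * 'rV[R]_n * 'rV[R]_n]
  (fun z : measurableTypeR R * 'rV[R]_n * 'rV[R]_n => (z.1.1, z.2)).
Proof. by apply: measurable_fun_pair => //; exact: (measurableT_comp (f := fst)). Qed.

Let mGc2 : measurable_fun [set: measurableTypeR R * 'rV[R]_n] (fun z => Gc z.2 z.1).
Proof.
apply: (@measurable_cosT _ _ _ (fun (z : measurableTypeR R * 'rV[R]_n) y => f (consrV (z.1, y)))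
  (fun z => z.2)).
- exact: (measurableT_comp mfc mp).
- exact: measurable_snd.
Qed.

Let mGs2 : measurable_fun [set: measurableTypeR R * 'rV[R]_n] (fun z => Gs z.2 z.1).
Proof.
apply: (@measurable_sinT _ _ _ (fun (z : measurableTypeR R * 'rV[R]_n) y => f (consrV (z.1, y)))
  (fun z => z.2)).
- exact: (measurableT_comp mfc mp).
- exact: measurable_snd.
Qed.

Let mGc e : measurable_fun [set: R] (Gc e).
Proof. exact: (measurable_fun_pair1 (f := fun z => Gc z.2 z.1) e mGc2). Qed.

Let mGs e : measurable_fun [set: R] (Gs e).
Proof. exact: (measurable_fun_pair1 (f := fun z => Gs z.2 z.1) e mGs2). Qed.

Let iGc e : leb.-integrable [set: R] (EFin \o Gc e).
Proof.
have [a [b [ia ib b0 fab]]] := tame_consrV_dominated tf.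
apply: (@dominated_integrable _ _ _ leb _ (fun x => a x * \int[mu n]_y b y)).
- exact: mGc.
- exact: (integrableZr measurableT _ ia).
move=> x; rewrite -RintegralZl//.
have [ms _] := tame_section x tf.
apply: normr_Rintegral_dominated.
- apply: measurable_funM => //; apply: measurable_cos_comp; exact: measurable_dot.
- exact: (integrableZl measurableT _ ib).
- move=> y; apply: le_trans (fab x y).
  by rewrite normrM ler_piMr// ler_norml cos_geN1 cos_le1.
Qed.

Let iGs e : leb.-integrable [set: R] (EFin \o Gs e).
Proof.
have [a [b [ia ib b0 fab]]] := tame_consrV_dominated tf.
apply: (@dominated_integrable _ _ _ leb _ (fun x => a x * \int[mu n]_y b y)).
- exact: mGs.
- exact: (integrableZr measurableT _ ia).
move=> x; rewrite -RintegralZl//.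
have [ms _] := tame_section x tf.
apply: normr_Rintegral_dominated.
- apply: measurable_funM => //; apply: measurable_sin_comp; exact: measurable_dot.
- exact: (integrableZl measurableT _ ib).
- move=> y; apply: le_trans (fab x y).
  by rewrite normrM ler_piMr// ler_norml sin_geN1 sin_le1.
Qed.

Local Notation C g s := (\int[leb]_x (g x * cos (x * s))).
Local Notation S g s := (\int[leb]_x (g x * sin (x * s))).

Let ics x e : (mu n).-integrable [set: 'rV[R]_n]
  (EFin \o (fun y => f (consrV (x, y)) * cos (dot y e))).
Proof. by apply: integrableM_cos (tame_integrable (tame_section x tf)); exact: measurable_dot. Qed.

Let isn x e : (mu n).-integrable [set: 'rV[R]_n]
  (EFin \o (fun y => f (consrV (x, y)) * sin (dot y e))).
Proof. by apply: integrableM_sin (tame_integrable (tame_section x tf)); exact: measurable_dot. Qed.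

Let iCc s e : leb.-integrable [set: R] (EFin \o (fun x => Gc e x * cos (x * s))).
Proof. apply: (@integrableM_cos _ _ _ leb _ _ _ (iGc e)); exact: (@measurable_funM _ _ R). Qed.

Let iSs s e : leb.-integrable [set: R] (EFin \o (fun x => Gs e x * sin (x * s))).
Proof. apply: (@integrableM_sin _ _ _ leb _ _ _ (iGs e)); exact: (@measurable_funM _ _ R). Qed.

Let iSc s e : leb.-integrable [set: R] (EFin \o (fun x => Gc e x * sin (x * s))).
Proof. apply: (@integrableM_sin _ _ _ leb _ _ _ (iGc e)); exact: (@measurable_funM _ _ R). Qed.

Let iCs s e : leb.-integrable [set: R] (EFin \o (fun x => Gs e x * cos (x * s))).
Proof. apply: (@integrableM_cos _ _ _ leb _ _ _ (iGs e)); exact: (@measurable_funM _ _ R). Qed.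

(** [Gc - i Gs] is the transform in the last n variables; this is the real part of its transform in
    the first one, and [sinT_consrV] is minus the imaginary part. *)
Let cosT_consrV s e : cosT f (consrV (s, e)) = C (Gc e) s - S (Gs e) s.
Proof.
have [a [b [ia ib b0 fab]]] := tame_consrV_dominated tf.
rewrite {1}/cosT (Rintegral_lebesgue_rVS _ ia ib).
- rewrite -RintegralB//.
  apply: eq_Rintegral => x _.
  rewrite /cosT /sinT -!RintegralZr ?ics ?isn// -RintegralB//.
  + by apply: eq_Rintegral => y _; rewrite dot_consrV cosD; ring.
  + exact: (integrableZr measurableT _ (ics x e)).
  + exact: (integrableZr measurableT _ (isn x e)).
- apply: measurable_funM => //; apply: measurable_cos_comp; exact: measurable_dot.
- move=> x y; apply: le_trans (fab x y).
  by rewrite normrM ler_piMr// ler_norml cos_geN1 cos_le1.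
Qed.

Let sinT_consrV s e : sinT f (consrV (s, e)) = S (Gc e) s + C (Gs e) s.
Proof.
have [a [b [ia ib b0 fab]]] := tame_consrV_dominated tf.
rewrite {1}/sinT (Rintegral_lebesgue_rVS _ ia ib).
- rewrite -RintegralD//.
  apply: eq_Rintegral => x _.
  rewrite /cosT /sinT -!RintegralZr ?ics ?isn// -RintegralD//.
  + by apply: eq_Rintegral => y _; rewrite dot_consrV sinD; ring.
  + exact: (integrableZr measurableT _ (ics x e)).
  + exact: (integrableZr measurableT _ (isn x e)).
- apply: measurable_funM => //; apply: measurable_sin_comp; exact: measurable_dot.
- move=> x y; apply: le_trans (fab x y).
  by rewrite normrM ler_piMr// ler_norml sin_geN1 sin_le1.
Qed.

Let mS2 (g : R -> R) : measurable_fun [set: R] g ->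
  measurable_fun [set: R] (fun s => C g s ^+ 2 + S g s ^+ 2).
Proof.
move=> mg; apply: measurable_funD; apply: measurable_funX.
  apply: (@measurable_param_Rintegral _ _ R (measurableTypeR R) R leb (fun s x => g x * cos (x * s))).
  apply: measurable_funM; first exact: measurableT_comp.
  by apply: measurable_cos_comp; exact: measurable_funM.
apply: (@measurable_param_Rintegral _ _ R (measurableTypeR R) R leb (fun s x => g x * sin (x * s))).
apply: measurable_funM; first exact: measurableT_comp.
by apply: measurable_sin_comp; exact: measurable_funM.
Qed.

Let E s e := cosT f (consrV (s, e)) ^+ 2 + sinT f (consrV (s, e)) ^+ 2.

Let mE : measurable_fun [set: measurableTypeR R * 'rV[R]_n] (fun z => E z.1 z.2).
Proof.
have mc : measurable_fun [set: measurableTypeR R * 'rV[R]_n] (fun z => consrV (z.1, z.2)).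
  by rewrite (_ : (fun z => _) = @consrV R n); [exact: measurable_consrV|apply/funext => -[]].
by apply: measurable_funD; apply: measurable_funX;
  [apply: measurable_cosT|apply: measurable_sinT] => //; exact: measurableT_comp.
Qed.

(** [bessel1] concerns real functions, while the partial transform is complex. Its two parts are
    separated by (p - t)^2 + (q + r)^2 <= 2 (p^2 + q^2 + r^2 + t^2), which doubles 32 to 64. *)
Let intE e : (\int[leb]_s (E s e)%:E <= (64 * pi)%:E *
  \int[leb]_x (Gc e x ^+ 2 + Gs e x ^+ 2)%:E)%E.
Proof.
apply: (@le_trans _ _ (\int[leb]_s (2%:E * ((C (Gc e) s ^+ 2 + S (Gc e) s ^+ 2)%:E
    + (C (Gs e) s ^+ 2 + S (Gs e) s ^+ 2)%:E)))%E).
  apply: ge0_le_integral => //.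
  - by move=> s _; rewrite lee_fin addr_ge0// sqr_ge0.
  - apply/measurable_EFinP.
    exact: (measurable_fun_pair1 (f := fun z => E z.1 z.2) e mE).
  - apply/measurable_EFinP; apply: measurable_funM => //.
    by apply: measurable_funD; exact: mS2.
  - move=> s _; rewrite -EFinD -EFinM lee_fin /E cosT_consrV sinT_consrV.
    move: (C (Gc e) s) (S (Gc e) s) (C (Gs e) s) (S (Gs e) s) => p q r t.
    have := sqr_ge0 (p + t); have := sqr_ge0 (q - r); nra.
rewrite ge0_integralZl//; last 2 first.
- by apply/measurable_EFinP; apply: measurable_funD; exact: mS2.
- by move=> s _; rewrite lee_fin !addr_ge0// sqr_ge0.
rewrite ge0_integralD//; last 4 first.
- by move=> s _; rewrite lee_fin !addr_ge0// sqr_ge0.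
- by apply/measurable_EFinP; exact: mS2.
- by move=> s _; rewrite lee_fin !addr_ge0// sqr_ge0.
- by apply/measurable_EFinP; exact: mS2.
under [X in (_ <= _ * X)%E]eq_integral do rewrite EFinD.
rewrite ge0_integralD//; last 4 first.
- by move=> s _; rewrite lee_fin sqr_ge0.
- by apply/measurable_EFinP; apply: measurable_funX; exact: mGc.
- by move=> s _; rewrite lee_fin sqr_ge0.
- by apply/measurable_EFinP; apply: measurable_funX; exact: mGs.
have -> : (64 * pi)%:E = (2%:E * (32 * pi)%:E)%E :> \bar R.
  by rewrite -EFinM; congr EFin; ring.
rewrite -muleA lee_wpmul2l ?lee_fin//.
rewrite ge0_muleDr; [|apply: integral_ge0 => x _; rewrite lee_fin sqr_ge0//..].
by apply: leeD; apply: bessel1; [exact: mGc|exact: iGc|exact: mGs|exact: iGs].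
Qed.

Hypothesis IH : forall g : 'rV[R]_n -> R, tame g ->
  (\int[mu n]_xi (cosT g xi ^+ 2 + sinT g xi ^+ 2)%:E <=
   ((64 * pi) ^+ n)%:E * \int[mu n]_x (g x ^+ 2)%:E)%E.

Let H x e := Gc e x ^+ 2 + Gs e x ^+ 2.

Let mH : measurable_fun [set: measurableTypeR R * 'rV[R]_n] (fun z => H z.1 z.2).
Proof. by apply: measurable_funD; apply: measurable_funX; [exact: mGc2|exact: mGs2]. Qed.

Let mintE : measurable_fun [set: 'rV[R]_n] (fun e => \int[leb]_s (E s e)%:E)%E.
Proof.
apply: (@measurable_param_ge0_integral _ _ _ (measurableTypeR R) R leb (fun e s => (E s e)%:E)).
  by apply/measurable_EFinP; exact: (measurableT_comp mE (measurable_fun_pair measurable_snd measurable_fst)).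
by move=> x y; rewrite lee_fin addr_ge0// sqr_ge0.
Qed.

Let mintH : measurable_fun [set: 'rV[R]_n] (fun e => \int[leb]_x (H x e)%:E)%E.
Proof.
apply: (@measurable_param_ge0_integral _ _ _ (measurableTypeR R) R leb (fun e x => (H x e)%:E)).
  by apply/measurable_EFinP; exact: (measurableT_comp mH (measurable_fun_pair measurable_snd measurable_fst)).
by move=> x y; rewrite lee_fin addr_ge0// sqr_ge0.
Qed.

(** [intE] treats the first variable at a fixed frequency e of the others; after Tonelli the
    induction hypothesis applies to the section of f at each fixed x. *)
Lemma bessel_step :
  (\int[mu n.+1]_xi (cosT f xi ^+ 2 + sinT f xi ^+ 2)%:E <=
   ((64 * pi) ^+ n.+1)%:E * \int[mu n.+1]_x (f x ^+ 2)%:E)%E.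
Proof.
have pi64 : 0 <= 64 * pi :> R by rewrite mulr_ge0// pi_ge0.
rewrite !ge0_integral_lebesgue_rVS; last 4 first.
- by apply/measurable_EFinP; exact: measurable_funX.
- by move=> v; rewrite lee_fin sqr_ge0.
- apply/measurable_EFinP; apply: measurable_funD; apply: measurable_funX.
    by apply: (measurable_cosT (f := fun _ => f)) => //; exact: measurableT_comp.
  by apply: (measurable_sinT (f := fun _ => f)) => //; exact: measurableT_comp.
- by move=> v; rewrite lee_fin addr_ge0// sqr_ge0.
rewrite (@fubini_tonelli _ _ (measurableTypeR R) _ R leb (mu n)
    (fun z => (E z.1 z.2)%:E)); last 2 first.
- exact/measurable_EFinP.
- by move=> z; rewrite lee_fin addr_ge0// sqr_ge0.
apply: (@le_trans _ _ (\int[mu n]_e ((64 * pi)%:E *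
  \int[leb]_x (Gc e x ^+ 2 + Gs e x ^+ 2)%:E))%E).
  apply: ge0_le_integral.
  - by [].
  - by move=> e _; apply: integral_ge0 => s _; rewrite lee_fin addr_ge0// sqr_ge0.
  - exact: mintE.
  - by apply: emeasurable_funM; [exact: measurable_cst|exact: mintH].
  - by move=> e _; exact: intE.
have H0 x e : (0 <= (H x e)%:E)%E by rewrite lee_fin addr_ge0// sqr_ge0.
rewrite ge0_integralZl; [|by []|exact: mintH
  |by move=> e _; apply: integral_ge0 => x _; exact: H0|by rewrite lee_fin].
have -> : (\int[mu n]_e \int[leb]_x (H x e)%:E = \int[leb]_x \int[mu n]_e (H x e)%:E)%E.
  apply/esym; apply: (@fubini_tonelli _ _ (measurableTypeR R) _ R leb (mu n)
    (fun z => (H z.1 z.2)%:E)).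
  - exact/measurable_EFinP.
  - by move=> z; exact: H0.
rewrite exprS [X in (_ <= X * _)%E]EFinM -muleA; apply: lee_wpmul2l; first by rewrite lee_fin.
have mf2 : measurable_fun [set: R] (fun x => \int[mu n]_y (f (consrV (x, y)) ^+ 2)%:E)%E.
  apply: (@measurable_param_ge0_integral _ _ R _ R (mu n)
      (fun x y => (f (consrV (x, y)) ^+ 2)%:E)).
    by apply/measurable_EFinP; apply: measurable_funX.
  by move=> x y; rewrite lee_fin sqr_ge0.
rewrite -ge0_integralZl; [|by []|exact: mf2| |by rewrite lee_fin exprn_ge0]; last first.
  by move=> x _; apply: integral_ge0 => y _; rewrite lee_fin sqr_ge0.
apply: ge0_le_integral.
- by [].
- by move=> x _; apply: integral_ge0 => e _; exact: H0.
- apply: (@measurable_param_ge0_integral _ _ R _ R (mu n) (fun x e => (H x e)%:E)).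
    exact/measurable_EFinP.
  by move=> x e; exact: H0.
- by apply: emeasurable_funM; [exact: measurable_cst|exact: mf2].
- by move=> x _; apply: IH; exact: tame_section.
Qed.

End step.

Lemma integral_rV0 (F : 'rV[R]_0 -> \bar R) : (\int[mu 0]_x F x)%E = F 0.
Proof.
rewrite (_ : F = cst (F 0)); last by apply/funext => x; congr F; apply/rowP => -[].
by rewrite integral_cst//= diracE mem_set// mule1.
Qed.

Lemma bessel_rV n (f : 'rV[R]_n -> R) : tame f ->
  (\int[mu n]_xi (cosT f xi ^+ 2 + sinT f xi ^+ 2)%:E <=
   ((64 * pi) ^+ n)%:E * \int[mu n]_x (f x ^+ 2)%:E)%E.
Proof.
elim: n f => [|n IH] f tf; last exact: bessel_step.
have d0 (x y : 'rV[R]_0) : dot x y = 0 by rewrite /dot big_ord0.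
rewrite expr0 mul1e !integral_rV0 lee_fin /cosT /sinT /Rintegral !integral_rV0 /=.
by rewrite !d0 cos0 sin0 mulr0 mulr1 expr0n addr0.
Qed.

End besseln.

(** * Covering the boundary *)

Section covering.
Context {R : realType}.

(* The upper box-counting content of dimension k of A is finite. *)
Definition covered n (A : set 'rV[R]_n) (k : nat) := exists C : R,
  forall d, 0 < d -> d <= 1 -> exists s : seq 'rV[R]_n,
    (size s)%:R * d ^+ k <= C /\
    forall x, A x -> exists2 c, c \in s & `|x - c| <= d.

Lemma coveredS n (A B : set 'rV[R]_n) k : A `<=` B -> covered B k -> covered A k.
Proof.
move=> AB [C cB]; exists C => d d0 d1; have [s [sC Bs]] := cB d d0 d1.
by exists s; split => // x /AB; exact: Bs.
Qed.

Lemma covered0 n k : covered (@set0 'rV[R]_n) k.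
Proof. by exists 0 => d d0 d1; exists [::]; split => //; rewrite mul0r. Qed.

Lemma coveredU n (A B : set 'rV[R]_n) k :
  covered A k -> covered B k -> covered (A `|` B) k.
Proof.
move=> [C cA] [C' cB]; exists (C + C') => d d0 d1.
have [s [sC As]] := cA d d0 d1; have [s' [sC' Bs]] := cB d d0 d1.
exists (s ++ s'); split; first by rewrite size_cat natrD mulrDl lerD.
by move=> x [/As|/Bs] [c cs xc]; exists c; rewrite // mem_cat cs ?orbT.
Qed.

(** A grid of mesh d with K + 1 points per axis, each coordinate being rounded down to the grid.
    Since d <= 1, (K + 1) d <= 2r + d <= 2r + 1. *)
Lemma covered_closed_ball m (c : 'rV[R]_m) (r : R) : 0 <= r ->
  covered [set x | `|x - c| <= r] m.
Proof.
move=> r0; exists ((2 * r + 1) ^+ m) => d d0 d1.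
pose K := Num.truncn (2 * r / d).
exists [seq \row_i (c 0 i - r + d * (f i)%:R) | f : {ffun 'I_m -> 'I_K.+1}].
split.
  rewrite size_map -cardE card_ffun !card_ord natrX -exprMn.
  rewrite lerXn2r ?nnegrE ?mulr_ge0 ?addr_ge0 ?mulr_ge0// ?(ltW d0)//.
  have : K%:R <= 2 * r / d by rewrite truncn_le divr_ge0 ?mulr_ge0// ltW.
  by rewrite ler_pdivlMr// -natr1; lra.
move=> x /(rV_norm_leP _ r0) xr.
pose t i := (x 0 i - (c 0 i - r)) / d.
have t0 i : 0 <= t i.
  by rewrite divr_ge0 ?(ltW d0)//; have := xr i; rewrite !mxE ler_norml; lra.
have tK i : (Num.truncn (t i) < K.+1)%N.
  rewrite ltnS; apply: le_truncn; rewrite ler_pM2r ?invr_gt0//.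
  by have := xr i; rewrite !mxE ler_norml; lra.
pose f := [ffun i => Ordinal (tK i)].
exists (\row_i (c 0 i - r + d * (f i)%:R)).
  by apply/mapP; exists f => //; rewrite mem_enum.
apply/(rV_norm_leP _ (ltW d0)) => i; rewrite !mxE ffunE /=.
have /andP[] := truncn_itv (t0 i); rewrite -natr1.
move: ((Num.truncn (t i))%:R) => k h1 h2.
have -> : x 0 i = c 0 i - r + d * t i.
  by rewrite /t mulrC divfK ?gt_eqF//; ring.
rewrite ler_norml; apply/andP; split; nra.
Qed.

(** The centres covering A need not lie in g(B), so each is replaced by a point of B whose image is
    close to it, if there is one. Two points of B near the same centre at scale d/(2L) have images
    within d/L, hence lie within d; L >= 1 keeps the scale below 1. *)
Lemma covered_inv_lipschitz m n (A : set 'rV[R]_m) (B : set 'rV[R]_n)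
    (g : 'rV[R]_n -> 'rV[R]_m) (L : R) k : 1 <= L ->
  (forall x, B x -> A (g x)) ->
  (forall x y, B x -> B y -> `|x - y| <= L * `|g x - g y|) ->
  covered A k -> covered B k.
Proof.
move=> L1 BA gL [C cA]; exists (C * (2 * L) ^+ k) => d d0 d1.
have L0 : 0 < L by exact: lt_le_trans L1.
have L20 : 0 < 2 * L by rewrite mulr_gt0.
have e0 : 0 < d / (2 * L) by rewrite divr_gt0.
have e1 : d / (2 * L) <= 1 by rewrite ler_pdivrMr//; lra.
have [s [sC As]] := cA _ e0 e1.
have /choice[rep hrep] : forall c, exists x, (exists2 y, B y & `|g y - c| <= d / (2 * L)) ->
    B x /\ `|g x - c| <= d / (2 * L).
  move=> c; have [[y By yc]|h] := pselect (exists2 y, B y & `|g y - c| <= d / (2 * L)).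
    by exists y.
  by exists 0 => h'.
exists (map rep s); split.
  rewrite size_map -[X in X ^+ k](divfK (lt0r_neq0 L20)) exprMn mulrA.
  by rewrite ler_pM2r// exprn_gt0.
move=> x Bx; have [c cs xc] := As _ (BA _ Bx).
have [|By yc] := hrep c; first by exists x.
exists (rep c); first exact: map_f.
apply: (le_trans (gL _ _ Bx By)).
rewrite mulrC -ler_pdivlMr//.
have -> : d / L = d / (2 * L) + d / (2 * L) by field; rewrite gt_eqF.
rewrite (_ : g x - g (rep c) = (g x - c) - (g (rep c) - c)); last first.
  by rewrite opprB addrA subrK.
by rewrite (le_trans (ler_normB _ _))// lerD.
Qed.

(** The two difference quotients are the same function, which brings the one-variable mean value
    theorem within reach of partial derivatives alone. *)
Lemma is_derive_line m (phi : 'rV[R]_m -> R) (p v : 'rV[R]_m) (t : R) :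
  derivable phi (t *: v + p) v ->
  is_derive t 1 (fun s => phi (s *: v + p)) ('D_v phi (t *: v + p)).
Proof.
move=> dphi.
have E : (fun h : R => h^-1 *: (((fun s => phi (s *: v + p)) \o shift t) (h *: (1 : R)) -
    phi (t *: v + p))) =
  (fun h : R => h^-1 *: ((phi \o shift (t *: v + p)) (h *: v) - phi (t *: v + p))).
  apply/funext => h /=; congr (_ *: (phi _ - _)).
  by rewrite [h *: 1]mulr1 scalerDl addrA.
split; first by rewrite /derivable E.
by rewrite /derive E.
Qed.

Section lipschitz.
Variables (m : nat) (phi : 'rV[R]_m -> R) (y0 : 'rV[R]_m) (r M : R).
Hypothesis phi_derivable : forall y i, `|y - y0| <= r ->
  derivable phi y (delta_mx 0 i) /\ `|'D_(delta_mx 0 i) phi y| <= M.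

Let lip_axis_lt (p : 'rV[R]_m) i (s t : R) : s <= t ->
  `|s *: delta_mx 0 i + p - y0| <= r -> `|t *: delta_mx 0 i + p - y0| <= r ->
  `|phi (t *: delta_mx 0 i + p) - phi (s *: delta_mx 0 i + p)| <= M * (t - s).
Proof.
move=> st sr tr.
have r0 : 0 <= r by exact: le_trans tr.
have ur u : s <= u <= t -> `|u *: delta_mx 0 i + p - y0| <= r.
  move=> /andP[su ut]; apply/(rV_norm_leP _ r0) => j.
  move: sr tr => /(rV_norm_leP _ r0)/(_ j) + /(rV_norm_leP _ r0)/(_ j).
  rewrite !mxE eqxx /=; case: (j == i); last by rewrite !mulr0.
  by rewrite !mulr1 !ler_norml; lra.
have du u : s <= u <= t -> is_derive u 1 (fun s => phi (s *: delta_mx 0 i + p))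
    ('D_(delta_mx 0 i) phi (u *: delta_mx 0 i + p)).
  by move=> sut; apply: is_derive_line; have [] := phi_derivable i (ur u sut).
have [|||c] := @MVT_segment R (fun u => phi (u *: delta_mx 0 i + p))
  (fun u => 'D_(delta_mx 0 i) phi (u *: delta_mx 0 i + p)) s t.
- by [].
- by move=> u; rewrite in_itv /= => /andP[? ?]; apply: du; rewrite !ltW.
- apply: derivable_within_continuous => u; rewrite in_itv /= => /du h.
  exact: ex_derive.
rewrite in_itv /= => sct ->; rewrite normrM.
have [_ h] := phi_derivable i (ur c sct).
by rewrite (@ger0_norm _ (t - s)) ?subr_ge0// ler_wpM2r// subr_ge0.
Qed.

Let lip_axis (p : 'rV[R]_m) i (s t : R) :
  `|s *: delta_mx 0 i + p - y0| <= r -> `|t *: delta_mx 0 i + p - y0| <= r ->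
  `|phi (t *: delta_mx 0 i + p) - phi (s *: delta_mx 0 i + p)| <= M * `|t - s|.
Proof.
move=> sr tr; have [st|/ltW ts] := lerP s t.
  exact: lip_axis_lt.
by rewrite distrC; exact: lip_axis_lt.
Qed.

(* Moving one coordinate at a time stays inside the sup-norm ball. *)
Lemma lipschitz_of_partial (y z : 'rV[R]_m) : 0 <= M ->
  `|y - y0| <= r -> `|z - y0| <= r -> `|phi y - phi z| <= m%:R * M * `|y - z|.
Proof.
move=> M0 yr zr; have r0 : 0 <= r by exact: le_trans yr.
pose p k : 'rV[R]_m := \row_i (if (i < k)%N then y 0 i else z 0 i).
have pr k : `|p k - y0| <= r.
  apply/(rV_norm_leP _ r0) => i.
  move: yr zr => /(rV_norm_leP _ r0)/(_ i) + /(rV_norm_leP _ r0)/(_ i).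
  by rewrite !mxE; case: ifP.
have step k : (k < m)%N -> `|phi (p k.+1) - phi (p k)| <= M * `|y - z|.
  move=> km; pose i := Ordinal km.
  have [q [pk pk1]] : exists q, p k = z 0 i *: delta_mx 0 i + q /\
      p k.+1 = y 0 i *: delta_mx 0 i + q.
    exists (p k - z 0 i *: delta_mx 0 i); split; first by rewrite addrC subrK.
    apply/rowP => j; rewrite !mxE eqxx /= ltnS leq_eqVlt.
    have [->|ji] := eqVneq j i; first by rewrite /= eqxx /= ltnn; ring.
    have /negbTE -> : nat_of_ord j != k by [].
    by rewrite /= !mulr0 add0r subr0.
  rewrite pk1 pk; apply: (le_trans (lip_axis _ _)).
  - by rewrite -pk.
  - by rewrite -pk1.
  - by rewrite ler_wpM2l//; have := rV_norm_coord (y - z) i; rewrite !mxE.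
have tele k : (k <= m)%N -> `|phi (p k) - phi (p 0)| <= k%:R * (M * `|y - z|).
  elim: k => [|k IH] km; first by rewrite subrr normr0 mul0r.
  rewrite (_ : phi (p k.+1) - phi (p 0) = (phi (p k.+1) - phi (p k)) + (phi (p k) - phi (p 0))); last first.
    by rewrite addrA subrK.
  rewrite (le_trans (ler_normD _ _))// -natr1 mulrDl mul1r addrC lerD//.
  - exact/IH/ltnW.
  - exact: step.
have pm : p m = y by apply/rowP => i; rewrite mxE ltn_ord.
have p0 : p 0%N = z by apply/rowP => i; rewrite mxE.
by have := tele m (leqnn m); rewrite pm p0 mulrA.
Qed.

End lipschitz.

(** By continuity at [y0] each partial derivative stays, on a small cube, below its absolute value
    at [y0] plus 1; [M0] is the sum of these bounds, so it serves all directions at once. *)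
Lemma C1_on_lipschitz m (W : set 'rV[R]_m) (phi : 'rV[R]_m -> R) y0 :
  open W -> C1_on W phi -> W y0 ->
  exists r M : R, [/\ 0 < r, 0 <= M & forall y z, `|y - y0| <= r -> `|z - y0| <= r ->
    `|phi y - phi z| <= M * `|y - z|].
Proof.
move=> oW C1 Wy0.
pose M0 := \sum_(i < m) (`|'D_(delta_mx 0 i) phi y0| + 1).
have nW : \forall y \near y0, W y by apply: open_nbhs_nbhs.
have nD : \forall y \near y0, forall i, `|'D_(delta_mx 0 i) phi y| <= `|'D_(delta_mx 0 i) phi y0| + 1.
  apply: (@filter_forall _ _ (fun i y => `|'D_(delta_mx 0 i) phi y| <=
    `|'D_(delta_mx 0 i) phi y0| + 1) (nbhs y0)) => i.
  have [_ cD] := C1 _ Wy0 i.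
  have /cvgrPdist_lt /(_ _ ltr01) := cD.
  apply: filterS => y h.
  rewrite -lerBlDl; apply: (le_trans (lerB_dist _ _)).
  by rewrite distrC ltW.
have : nbhs y0 (W `&` [set y | forall i, `|'D_(delta_mx 0 i) phi y| <=
    `|'D_(delta_mx 0 i) phi y0| + 1]) by apply: filterI.
move=> /nbhs_ballP[e /= e0 eP].
have M00 : 0 <= M0 by apply: sumr_ge0 => i _; rewrite addr_ge0.
exists (e / 2), (m%:R * M0); split; [by rewrite divr_gt0|by rewrite mulr_ge0|].
move=> y z yr zr; apply: (@lipschitz_of_partial _ _ y0 (e / 2)) => // x i xr.
have [Wx Dx] : W x /\ forall i, `|'D_(delta_mx 0 i) phi x| <= `|'D_(delta_mx 0 i) phi y0| + 1.
  apply: eP; rewrite mx_norm_ball /ball_ /= distrC.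
  by rewrite (le_lt_trans xr)// ltr_pdivrMr// ltr_pMr// ltr1n.
split; first by have [] := C1 _ Wx i.
apply: (le_trans (Dx i)).
rewrite /M0 (bigD1 i)//= lerDl; apply: sumr_ge0 => j _; exact: addr_ge0.
Qed.

Lemma rV_norm_mulmx n m (x : 'rV[R]_n) (Q : 'M[R]_(n, m)) :
  `|x *m Q| <= (\sum_i \sum_j `|Q i j|) * `|x|.
Proof.
have s0 : 0 <= \sum_i \sum_j `|Q i j| by apply: sumr_ge0 => i _; exact: sumr_ge0.
apply/rV_norm_leP; first exact: mulr_ge0.
move=> j; rewrite mxE; apply: (le_trans (ler_norm_sum _ _ _)).
rewrite mulr_suml; apply: ler_sum => i _.
rewrite normrM mulrC ler_pM// ?rV_norm_coord//.
by rewrite (bigD1 j)//= lerDl sumr_ge0.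
Qed.

(** On the graph the projection [g] to the independent coordinates has a Lipschitz inverse, so the
    boundary inherits the count of a cube in n - 1 dimensions. *)
Lemma covered_C1_boundary_local n (D : set 'rV[R]_n) a :
  C1_boundary D -> boundary D a ->
  exists2 e, 0 < e & covered (boundary D `&` ball a e) n.-1.
Proof.
move=> C1 Da; have [V [Q [k [W [phi [[oV Va] QQ oW Wphi E]]]]]] := C1 a Da.
pose g (x : 'rV[R]_n) : 'rV[R]_n.-1 := col' k (x *m Q).
have EP x : boundary D x -> V x -> W (g x) /\ (x *m Q) 0 k = phi (g x).
  by move=> Dx Vx; have : (boundary D `&` V) x by []; rewrite E.
have [Wga _] := EP a Da Va.
have [r [M [r0 M0 lip]]] := C1_on_lipschitz oW Wphi Wga.
(* The sup norm is not invariant under Q: [q] and [q'] bound the operator norms of Q and of its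
   inverse, the transpose. *)
pose q := \sum_i \sum_j `|Q i j|.
pose q' := \sum_i \sum_j `|Q^T i j|.
have q0 : 0 <= q by apply: sumr_ge0 => i _; exact: sumr_ge0.
have q'0 : 0 <= q' by apply: sumr_ge0 => i _; exact: sumr_ge0.
have gq x y : `|g x - g y| <= q * `|x - y|.
  apply: (le_trans _ (rV_norm_mulmx (x - y) Q)).
  apply/rV_norm_leP => // i; rewrite mulmxBl.
  by have := rV_norm_coord (x *m Q - y *m Q) (lift k i); rewrite !mxE.
have /nbhs_ballP[e1 /= e10 e1V] := open_nbhs_nbhs (conj oV Va).
(* [e1] keeps the ball inside the chart, and r/(q+1) keeps its projection where phi is Lipschitz;
   the +1 avoids a zero denominator. *)
exists (Num.min e1 (r / (q + 1))).
  by rewrite lt_min e10 divr_gt0// ltr_wpDl.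
apply: (@covered_inv_lipschitz _ _ [set y | `|y - g a| <= r] _ g (q' * (M + 1) + 1)).
- by rewrite lerDr mulr_ge0// addr_ge0.
- move=> x [_]; rewrite mx_norm_ball /ball_ /= lt_min distrC => /andP[_ h].
  apply: (le_trans (gq _ _)).
  move: h; rewrite ltr_pdivlMr ?ltr_wpDl// => h.
  by have := normr_ge0 (x - a); lra.
- move=> x y [Dx hx] [Dy hy].
  have Vx : V x by apply: e1V; apply: le_ball hx; rewrite ge_min lexx.
  have Vy : V y by apply: e1V; apply: le_ball hy; rewrite ge_min lexx.
  have gr z : ball a (Num.min e1 (r / (q + 1))) z -> `|g z - g a| <= r.
    rewrite mx_norm_ball /ball_ /= lt_min distrC => /andP[_ h].
    apply: (le_trans (gq _ _)).
    move: h; rewrite ltr_pdivlMr ?ltr_wpDl// => h.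
    by have := normr_ge0 (z - a); lra.
  have [_ kx] := EP x Dx Vx; have [_ ky] := EP y Dy Vy.
  have xyQ : `|x *m Q - y *m Q| <= (M + 1) * `|g x - g y|.
    apply/rV_norm_leP; first by rewrite mulr_ge0// addr_ge0.
    move=> j; have [j' ->|->] := unliftP k j.
      have := rV_norm_coord (g x - g y) j'; rewrite !mxE => h.
      by rewrite mulrDl mul1r (le_trans h)// lerDr mulr_ge0.
    rewrite !mxE in kx ky *; rewrite kx ky.
    apply: (le_trans (lip _ _ (gr _ hx) (gr _ hy))).
    by rewrite mulrDl mul1r lerDl.
  have -> : x - y = (x *m Q - y *m Q) *m Q^T.
    by rewrite -mulmxBl -mulmxA QQ mulmx1.
  apply: (le_trans (rV_norm_mulmx _ _)).
  apply: (@le_trans _ _ (q' * ((M + 1) * `|g x - g y|))); first by rewrite ler_wpM2l.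
  by rewrite mulrA mulrDl mul1r lerDl.
- by apply: covered_closed_ball; exact: ltW.
Qed.

Lemma covered_C1_boundary n (D : set 'rV[R]_n) :
  bounded_set D -> C1_boundary D -> covered (boundary D) n.-1.
Proof.
move=> bD C1.
have cbD : compact (boundary D).
  have [B [_ DB]] := bD.
  apply: bounded_closed_compact.
    (* D is bounded by B + 1, and a boundary point lies within distance 1 of D. *)
    exists (B + 2); split; first exact: num_real.
    move=> b Bb x [cDx _].
    have [y [Dy]] := cDx _ (nbhsx_ballx x 1 ltr01).
    rewrite mx_norm_ball /ball_ /= => xy1.
    have := DB (B + 1); rewrite ltrDl ltr01 => /(_ isT y Dy) /= By.
    rewrite -(subrK y x) (le_trans (ler_normD _ _))//.
    by move: Bb xy1 By; lra.
  apply: closedI; first exact: closed_closure.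
  by apply: open_closedC; exact: open_interior.
have /choice[e he] : forall a, exists e, boundary D a ->
    0 < e /\ covered (boundary D `&` ball a e) n.-1.
  move=> a; have [Da|] := pselect (boundary D a); last by exists 0.
  by have [e e0 ce] := covered_C1_boundary_local C1 Da; exists e.
move: cbD; rewrite compact_cover => /(_ _ (boundary D) (fun a => ball a (e a))) [].
- by move=> a _; exact: ball_open.
- by move=> a Da; exists a => //; apply: ballxx; have [] := he a Da.
move=> S SD Scov.
apply: (@coveredS _ _ (\big[setU/set0]_(a <- finmap.enum_fset S) (boundary D `&` ball a (e a)))).
  move=> x Dx; have [a aS xa] := Scov x Dx.
  by rewrite -bigcup_seq; exists a.
rewrite big_seq; elim/big_ind : _.
- exact: covered0.
- by move=> *; exact: coveredU.
- by move=> a aS; have [] := he a (set_mem (SD a aS)).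
Qed.

End covering.

(** * Decay of the Fourier transform of an indicator *)

Section shell.
Context {R : realType}.
Local Notation mu n := (@lebesgue_rV R n).

(** If the segment from x to y missed the boundary, D and its closure would cut out the same subset
    of [0, 1], both open and closed in it; by connectedness it would contain 1, that is, y. *)
Lemma boundary_crossing n (D : set 'rV[R]_n) (x y : 'rV[R]_n) : open D ->
  D x -> ~ D y -> exists2 z, boundary D z & `|x - z| <= `|x - y| /\ `|y - z| <= `|x - y|.
Proof.
move=> oD Dx nDy; apply: contrapT => noz.
pose c (t : R) := x + t *: (y - x).
have cc : continuous c.
  move=> t; apply: cvgD; first exact: cvg_cst.
  by apply: cvgZ; [exact: cvg_id|exact: cvg_cst].
have nbd t : 0 <= t <= 1 -> ~ boundary D (c t).
  move=> /andP[t0 t1] bd; apply: noz; exists (c t) => //; split.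
    rewrite /c opprD addrA subrr add0r normrN normrZ ger0_norm// distrC ler_piMl//.
  rewrite (_ : y - c t = (1 - t) *: (y - x)); last first.
    by rewrite /c scalerBl scale1r opprD addrA.
  by rewrite normrZ ger0_norm ?subr_ge0// (distrC y x) ler_piMl// gerBl.
have E : `[0, 1]%classic `&` c @^-1` D = `[0, 1]%classic.
  apply: (@segment_connected R 0 1).
  - by exists 0; split; rewrite /= ?in_itv /= ?lexx ?ler01// /c scale0r addr0.
  - by exists (c @^-1` D) => //; apply: open_comp => // t _; exact: cc.
  - exists (c @^-1` closure D).
      by apply: closed_comp => [t _|]; [exact: cc|exact: closed_closure].
    apply/seteqP; split => t [t01 Dt]; split => //; first exact: subset_closure.
    apply: contrapT => nDt; apply: (nbd t); first by move: t01; rewrite /= in_itv.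
    by split => // /interior_subset.
move/seteqP: E => [_ /(_ 1)] [].
  by rewrite /= in_itv /= ler01 lexx.
by move=> _; rewrite /= /c scale1r addrC subrK.
Qed.

Lemma indic_translation_neq n (D : set 'rV[R]_n) (x v : 'rV[R]_n) : open D ->
  \1_D (x + v) != \1_D x :> R -> exists2 z, boundary D z & `|x - z| <= `|v|.
Proof.
move=> oD; rewrite !indicE.
have [Dx|nDx] := pselect (D x); have [Dxv|nDxv] := pselect (D (x + v)).
- by rewrite !mem_set ?eqxx.
- move=> _; have [z bz [xz _]] := boundary_crossing oD Dx nDxv.
  by exists z => //; rewrite (le_trans xz)// opprD addrA subrr add0r normrN.
- move=> _; have [z bz [_ xz]] := boundary_crossing oD Dxv nDx.
  by exists z => //; rewrite (le_trans xz)// addrC addKr.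
- by rewrite !memNset ?eqxx.
Qed.

(** The integrand is 0 or 1, and nonzero only within |v| of the boundary. Doubling a cover of the
    boundary by balls of radius |v| catches all such points: at most C |v|^(1-n) cubes, each of
    measure (4 |v|)^n. *)
Lemma integral_indic_translation n (D : set 'rV[R]_n) : (0 < n)%N -> open D ->
  covered (boundary D) n.-1 -> exists2 C : R, 0 <= C &
  forall v : 'rV[R]_n, 0 < `|v| -> `|v| <= 1 ->
    (\int[mu n]_x ((\1_D (x + v) - \1_D x) ^+ 2)%:E <= (C * `|v|)%:E)%E.
Proof.
move=> n0 oD [C cD]; exists (`|C| * 4 ^+ n); first by rewrite mulr_ge0// exprn_ge0.
move=> v v0 v1; have [s [sC Ds]] := cD _ v0 v1.
pose B (c : 'rV[R]_n) := [set x | `|x - c| <= 2 * `|v|].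
have v20 : 0 <= 2 * `|v| by rewrite mulr_ge0.
have mB c : measurable (B c) by exact: measurable_closed_ball_rV.
have mD := open_measurable_rV oD.
have mI : measurable_fun [set: 'rV[R]_n] (\1_D : _ -> R) by exact: measurable_indic.
apply: (@le_trans _ _ (\int[mu n]_x (\sum_(c <- s) (\1_(B c) x)%:E))%E).
  apply: ge0_le_integral.
  - by [].
  - by move=> x _; rewrite lee_fin sqr_ge0.
  - apply/measurable_EFinP; apply: measurable_funX; apply: measurable_funB => //.
    by apply: measurableT_comp => //; exact: measurable_translation.
  - by apply: emeasurable_sum => c; apply/measurable_EFinP; exact: measurable_indic.
  - move=> x _; rewrite sumEFin lee_fin.
    have [->|neq] := eqVneq (\1_D (x + v)) (\1_D x : R).
      by rewrite subrr expr0n /= sumr_ge0// => c _; rewrite indicE.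
    have [z bz xz] := indic_translation_neq oD neq.
    have [c cs zc] := Ds z bz.
    apply: (@le_trans _ _ 1).
      rewrite !indicE; do 2 case: (_ \in _) => /=; rewrite ?subrr ?subr0 ?sub0r ?sqrrN ?expr0n ?expr1n//.
    rewrite (big_rem c)//= indicE mem_set ?lerDl ?sumr_ge0//.
    rewrite /B /= (_ : x - c = (x - z) + (z - c)); last by rewrite addrA subrK.
    by rewrite (le_trans (ler_normD _ _))// mulr_natl mulr2n lerD.
rewrite ge0_integral_sum//; last first.
  by move=> c; apply/measurable_EFinP; exact: measurable_indic.
have E c : (\int[mu n]_x (\1_(B c) x)%:E = ((2 * (2 * `|v|)) ^+ n)%:E)%E.
  by rewrite integral_indic// setIT; exact: (lebesgue_closed_ball_rV c v20).
under eq_bigr do rewrite E.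
rewrite sumEFin lee_fin big_const_seq count_predT iter_addr_0 -[leLHS]mulr_natl.
have -> : 2 * (2 * `|v|) = 4 * `|v| by ring.
have -> : (4 * `|v|) ^+ n = `|v| ^+ n.-1 * (4 ^+ n * `|v|).
  by rewrite mulrCA -exprSr prednK// exprMn.
rewrite [leLHS]mulrA -[leRHS]mulrA ler_wpM2r ?mulr_ge0 ?exprn_ge0//.
by rewrite (le_trans sC)// ler_norm.
Qed.

Section fourier_indic.
Variables (n : nat) (D : set 'rV[R]_n).
Hypotheses (oD : open D) (bD : bounded_set D).

Let f : 'rV[R]_n -> R := \1_D.

Let mf : measurable_fun [set: 'rV[R]_n] f.
Proof. by apply: measurable_indic; exact: open_measurable_rV. Qed.

Lemma tame_indic : tame f.
Proof.
split; first exact: mf.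
have [B [_ DB]] := bD; exists 1, (B + 1); split.
  by move=> x; rewrite /f indicE; case: (_ \in _); rewrite ?normr0 ?normr1.
move=> x Bx; rewrite /f indicE memNset// => Dx.
by have := DB (B + 1); rewrite ltrDl ltr01 => /(_ isT x Dx) /=; rewrite leNgt Bx.
Qed.

Let fv (v x : 'rV[R]_n) := f (x + v).
Let g v x := fv v x - f x.

Lemma tame_translation v : tame (fv v).
Proof.
have [_ [M [L [fM fL]]]] := tame_indic; split.
  by apply: measurableT_comp; [exact: mf|exact: measurable_translation].
exists M, (L + `|v|); split => [x|x Lx]; first exact: fM.
apply: fL; rewrite -(ltrD2r `|v|) (lt_le_trans Lx)//.
by rewrite -{1}(addrK v x) ler_normB.
Qed.

Lemma tame_indicB v : tame (g v).
Proof.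
have [mv [M [L [fM fL]]]] := tame_translation v.
have [_ [M' [L' [fM' fL']]]] := tame_indic.
split; first by apply: measurable_funB; [exact: mv|exact: mf].
exists (M + M'), (Num.max L L'); split => [x|x].
  by rewrite (le_trans (ler_normB _ _))// lerD.
by rewrite gt_max => /andP[h h']; rewrite /g fL// fL'// subrr.
Qed.

Lemma dotDl (x y z : 'rV[R]_n) : dot (x + y) z = dot x z + dot y z.
Proof.
by rewrite /dot -big_split /=; apply: eq_bigr => i _; rewrite mxE mulrDl.
Qed.

Let ic (h : 'rV[R]_n -> R) xi : tame h -> (mu n).-integrable [set: 'rV[R]_n]
  (EFin \o (fun x => h x * cos (dot x xi))).
Proof. by move=> th; apply: integrableM_cos (tame_integrable th); exact: measurable_dot. Qed.

Let isn (h : 'rV[R]_n -> R) xi : tame h -> (mu n).-integrable [set: 'rV[R]_n]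
  (EFin \o (fun x => h x * sin (dot x xi))).
Proof. by move=> th; apply: integrableM_sin (tame_integrable th); exact: measurable_dot. Qed.

(** Real form of the multiplication by e^(i(v,xi)). Here the right side is the one translated by v;
    the addition formulas then leave a factor cos^2 + sin^2 = 1. *)
Let cosT_fv v xi : cosT (fv v) xi = cos (dot v xi) * cosT f xi + sin (dot v xi) * sinT f xi.
Proof.
rewrite /cosT /sinT -!RintegralZl; [|by []|exact: (isn _ tame_indic)|by []|exact: (ic _ tame_indic)].
rewrite -RintegralD; [|by []| |]; last 2 first.
- exact: (integrableZl measurableT (cos (dot v xi)) (ic xi tame_indic)).
- exact: (integrableZl measurableT (sin (dot v xi)) (isn xi tame_indic)).
rewrite -[RHS](Rintegral_translation_rV v); last first.
  by apply: measurable_funD; apply: measurable_funM => //; apply: measurable_funM => //;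
    [apply: measurable_cos_comp|apply: measurable_sin_comp]; exact: measurable_dot.
apply: eq_Rintegral => x _; rewrite /fv dotDl cosD sinD.
have := cos2Dsin2 (dot v xi); move: (cos (dot v xi)) (sin (dot v xi)) => c s cs.
rewrite -[in LHS](mulr1 (f _)) -cs; ring.
Qed.

Let sinT_fv v xi : sinT (fv v) xi = cos (dot v xi) * sinT f xi - sin (dot v xi) * cosT f xi.
Proof.
rewrite /cosT /sinT -!RintegralZl; [|by []|exact: (ic _ tame_indic)|by []|exact: (isn _ tame_indic)].
rewrite -RintegralB; [|by []| |]; last 2 first.
- exact: (integrableZl measurableT (cos (dot v xi)) (isn xi tame_indic)).
- exact: (integrableZl measurableT (sin (dot v xi)) (ic xi tame_indic)).
rewrite -[RHS](Rintegral_translation_rV v); last first.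
  by apply: measurable_funB; apply: measurable_funM => //; apply: measurable_funM => //;
    [apply: measurable_sin_comp|apply: measurable_cos_comp]; exact: measurable_dot.
apply: eq_Rintegral => x _; rewrite /fv dotDl cosD sinD.
have := cos2Dsin2 (dot v xi); move: (cos (dot v xi)) (sin (dot v xi)) => c s cs.
rewrite -[in LHS](mulr1 (f _)) -cs; ring.
Qed.

Local Notation P xi := (cosT f xi ^+ 2 + sinT f xi ^+ 2).

(** The factor is |e^(i theta) - 1|^2 = 2 - 2 cos theta. *)
Let sqr_indicB v xi : cosT (g v) xi ^+ 2 + sinT (g v) xi ^+ 2 =
  (2 - 2 * cos (dot v xi)) * P xi.
Proof.
have -> : cosT (g v) xi = cosT (fv v) xi - cosT f xi.
  rewrite /cosT -RintegralB; [|by []|exact: (ic _ (tame_translation v))|exact: (ic _ tame_indic)].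
  by apply: eq_Rintegral => x _; rewrite /g mulrBl.
have -> : sinT (g v) xi = sinT (fv v) xi - sinT f xi.
  rewrite /sinT -RintegralB; [|by []|exact: (isn _ (tame_translation v))|exact: (isn _ tame_indic)].
  by apply: eq_Rintegral => x _; rewrite /g mulrBl.
rewrite cosT_fv sinT_fv.
have := cos2Dsin2 (dot v xi).
move: (cos (dot v xi)) (sin (dot v xi)) (cosT f xi) (sinT f xi) => c s C S cs.
transitivity (((c ^+ 2 + s ^+ 2) + 1 - 2 * c) * (C ^+ 2 + S ^+ 2)); first by ring.
by rewrite cs; congr (_ * _); ring.
Qed.

Lemma measurable_fourier_sqr : measurable_fun [set: 'rV[R]_n] (fun xi => P xi).
Proof.
by apply: measurable_funD; apply: measurable_funX;
  [apply: (measurable_cosT (f := fun _ => f))|apply: (measurable_sinT (f := fun _ => f))] => //;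
  exact: measurableT_comp.
Qed.

Lemma fourier_sqr_ge0 xi : 0 <= P xi.
Proof. by rewrite addr_ge0// sqr_ge0. Qed.

(** Cubical shells: scaled by 2^-k, the dominant coordinate of xi falls exactly in the interval (1,
    2]. *)
Definition shell (k : nat) : set 'rV[R]_n := [set xi | 2 ^+ k < `|xi| <= 2 ^+ k.+1].

Lemma measurable_shell k : measurable (shell k).
Proof.
rewrite (_ : shell k = [set x | `|x - 0| <= 2 ^+ k.+1] `\` [set x | `|x - 0| <= 2 ^+ k]).
  by apply: measurableD; apply: measurable_closed_ball_rV; exact: exprn_ge0.
apply/seteqP; split => x /=; rewrite subr0.
  by move=> /andP[h1 h2]; split => //; apply/negP; rewrite -ltNge.
by move=> [h1 /negP]; rewrite -ltNge => h2; apply/andP.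
Qed.

Let dot_axis (h : R) (i : 'I_n) (xi : 'rV[R]_n) : dot (h *: delta_mx 0 i) xi = h * xi 0 i.
Proof.
rewrite /dot (bigD1 i)//= big1 ?addr0 => [|j ji]; first by rewrite !mxE !eqxx mulr1.
by rewrite !mxE eqxx (negbTE ji) mulr0 mul0r.
Qed.

Let norm_axis (h : R) (i : 'I_n) : 0 <= h -> `|h *: delta_mx 0 i : 'rV[R]_n| = h.
Proof.
move=> h0; rewrite normrZ ger0_norm//.
suff -> : `|delta_mx 0 i : 'rV[R]_n| = 1 by rewrite mulr1.
apply/eqP; rewrite eq_le; apply/andP; split.
  by apply/rV_norm_leP => // j; rewrite !mxE eqxx; case: eqP; rewrite ?normr1 ?normr0.
by have := rV_norm_coord (delta_mx 0 i : 'rV[R]_n) i; rewrite !mxE !eqxx normr1.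
Qed.

Lemma cos1_lt1 : cos 1 < 1 :> R.
Proof.
have pi2 := pi_ge2 R.
by rewrite -[ltRHS]cos0 ltr_cos ?ltr01// in_itv /=; lra.
Qed.

(* [2 < pi], so that [`|t|] stays in the range where cos decreases. *)
Lemma cos_le_cos1 (t : R) : 1 <= `|t| <= 2 -> cos t <= cos 1.
Proof.
have pi2 := pi_ge2 R; move=> /andP[t1 t2].
rewrite -cos_norm leNgt ltr_cos -?leNgt// in_itv /=; lra.
Qed.

Lemma shell_estimate : (0 < n)%N -> covered (boundary D) n.-1 -> exists2 C : R, 0 <= C &
  forall k, (\int[mu n]_(xi in shell k) (P xi)%:E <= (C * 2 ^- k)%:E)%E.
Proof.
move=> n0 cD; have [C C0 hC] := integral_indic_translation n0 oD cD.
(* The minimum of |e^(i theta) - 1|^2 over 1 <= |theta| <= 2. *)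
pose c0 : R := 2 - 2 * cos 1.
have c00 : 0 < c0 by have := cos1_lt1; rewrite /c0; lra.
have pin : 0 <= (64 * pi) ^+ n :> R by rewrite exprn_ge0// mulr_ge0// pi_ge0.
exists (c0^-1 * (n%:R * ((64 * pi) ^+ n * C))).
  by rewrite !mulr_ge0// invr_ge0 ltW.
move=> k; pose h : R := 2 ^- k.
have h0 : 0 < h by rewrite invr_gt0 exprn_gt0.
have h1 : h <= 1 by rewrite invf_le1 ?exprn_gt0// exprn_ege1// ler1n.
pose v i : 'rV[R]_n := h *: delta_mx 0 i.
have vh i : `|v i| = h by apply: norm_axis; exact: ltW.
pose G i xi := cosT (g (v i)) xi ^+ 2 + sinT (g (v i)) xi ^+ 2.
have GE i xi : G i xi = (2 - 2 * cos (h * xi 0 i)) * P xi by rewrite /G sqr_indicB dot_axis.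
have G0 i xi : 0 <= G i xi by rewrite addr_ge0// sqr_ge0.
have mG i : measurable_fun [set: 'rV[R]_n] (G i).
  have [mg _] := tame_indicB (v i).
  by apply: measurable_funD; apply: measurable_funX;
    [apply: (measurable_cosT (f := fun _ => g (v i)))|apply: (measurable_sinT (f := fun _ => g (v i)))] => //;
    exact: measurableT_comp.
(* Summing over all axes avoids splitting the shell by dominant coordinate: at each xi the term of a
   dominant axis suffices, and the others are non-negative. *)
apply: (@le_trans _ _ (\int[mu n]_xi (c0^-1%:E * \sum_(i < n) (G i xi)%:E))%E).
  apply: (@le_trans _ _ (\int[mu n]_(xi in shell k) (c0^-1%:E * \sum_(i < n) (G i xi)%:E))%E).
    apply: ge0_le_integral.
    - exact: measurable_shell.
    - by move=> xi _; rewrite lee_fin fourier_sqr_ge0.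
    - by apply/measurable_EFinP; apply: measurable_funTS; exact: measurable_fourier_sqr.
    - apply: emeasurable_funM; first exact: measurable_cst.
      by apply: emeasurable_sum => i; apply/measurable_EFinP; apply: measurable_funTS; exact: mG.
    - move=> xi /= /andP[xi1 xi2].
      rewrite sumEFin -EFinM lee_fin -ler_pdivrMl ?invr_gt0// invrK.
      have xi0 : 0 < `|xi| by apply: le_lt_trans xi1; exact: exprn_ge0.
      have [i xiE] := rV_norm_attained xi0.
      rewrite (bigD1 i)//= (@le_trans _ _ (G i xi))//; last first.
        by rewrite lerDl sumr_ge0.
      rewrite GE ler_wpM2r ?fourier_sqr_ge0// /c0.
      suff : cos (h * xi 0 i) <= cos 1 by lra.
      apply: cos_le_cos1; rewrite normrM (gtr0_norm h0) -xiE.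
      rewrite /h ler_pdivlMl ?exprn_gt0// ler_pdivrMl ?exprn_gt0//.
      by rewrite mulr1 (ltW xi1) -exprSr xi2.
  apply: ge0_subset_integral => //.
  - exact: measurable_shell.
  - apply: emeasurable_funM; first exact: measurable_cst.
    by apply: emeasurable_sum => i; apply/measurable_EFinP; exact: mG.
  - move=> xi _; rewrite mule_ge0 ?lee_fin ?invr_ge0 ?(ltW c00)//.
    by rewrite sume_ge0// => i _; rewrite lee_fin.
rewrite ge0_integralZl; [|by []| | |]; last 3 first.
- by apply: emeasurable_sum => i; apply/measurable_EFinP; exact: mG.
- by move=> xi _; rewrite sume_ge0// => i _; rewrite lee_fin.
- by rewrite lee_fin invr_ge0 ltW.
rewrite -[in leRHS]mulrA EFinM lee_wpmul2l ?lee_fin ?invr_ge0 ?(ltW c00)//.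
rewrite ge0_integral_sum; [|by []| |]; last 2 first.
- by move=> i; apply/measurable_EFinP; exact: mG.
- by move=> i xi _; rewrite lee_fin.
apply: (@le_trans _ _ (\sum_(i < n) ((64 * pi) ^+ n * C * h)%:E)%E).
  apply: lee_sum => i _.
  apply: (le_trans (bessel_rV (tame_indicB (v i)))).
  rewrite -mulrA EFinM lee_wpmul2l ?lee_fin//.
  by rewrite -(vh i); apply: hC; rewrite vh.
by rewrite sumEFin lee_fin sumr_const card_ord -[leLHS]mulr_natl !mulrA.
Qed.

End fourier_indic.
End shell.

(** * From shell estimates to integrability of powers *)

Section powR_integral.
Context {R : realType}.
Local Notation mu n := (@lebesgue_rV R n).

(* Replaces Hoelder's inequality: applied on the k-th shell with
   l = 2^(-k(n+1)), which balances the L^2 bound against the volume. *)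
Lemma powR_le_affine (a l s : R) : 0 <= a -> 0 < l -> 0 <= s -> s <= 1 ->
  a `^ s <= l `^ s * (a / l + 1).
Proof.
move=> a0 l0 s0 s1; have al0 : 0 <= a / l by rewrite divr_ge0// ltW.
have -> : a `^ s = l `^ s * (a / l) `^ s.
  by rewrite -powRM ?(ltW l0)// mulrC divfK// gt_eqF.
rewrite ler_wpM2l ?powR_ge0//; have [al1|al1] := lerP 1 (a / l).
  by rewrite (le_trans (ler1_powR al1 s1))// lerDl.
rewrite (@le_trans _ _ (1 `^ s))//.
  by rewrite ge0_ler_powR// ?nnegrE// ltW.
by rewrite powR1 lerDr.
Qed.

Lemma powRX (x s : R) k : 0 <= x -> (x ^+ k) `^ s = (x `^ s) ^+ k.
Proof. by move=> x0; rewrite -(powR_mulrn k x0) powRAC powR_mulrn// powR_ge0. Qed.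

(** The ratio is 2^(n - (n+1)s); the critical exponent is the one at which it equals 1. *)
Lemma ratio_lt1 n (s : R) : n%:R / n.+1%:R < s ->
  ((2 ^+ n.+1)^-1) `^ s * 2 ^+ n < 1 :> R.
Proof.
move=> hs; set X : R := 2 ^+ n.+1.
have X0 : 0 < X by exact: exprn_gt0.
have X1 : 1 < X by rewrite exprn_egt1// ltr1n.
have e : (X^-1) `^ s = (X `^ s)^-1.
  apply: (mulfI (lt0r_neq0 (powR_gt0 s X0))).
  by rewrite mulfV ?(lt0r_neq0 (powR_gt0 s X0))// -powRM ?invr_ge0 ?(ltW X0)// mulfV ?gt_eqF// powR1.
rewrite e mulrC ltr_pdivrMr ?powR_gt0// mul1r.
have -> : 2 ^+ n = X `^ (n%:R / n.+1%:R).
  by rewrite /X -(powR_mulrn n.+1 (ler0n R 2)) -powRrM mulrC divfK// powR_mulrn.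
rewrite -[ltRHS](_ : X `^ (n%:R / n.+1%:R + (s - n%:R / n.+1%:R)) = _); last first.
  by rewrite addrC subrK.
rewrite powRD ?(lt0r_neq0 X0) ?implybT// ltr_pMr ?powR_gt0//.
apply: (@le_lt_trans _ _ (1 `^ (s - n%:R / n.+1%:R))); first by rewrite powR1.
by rewrite gt0_ltr_powR ?nnegrE ?subr_gt0// ltW.
Qed.

(** The shells fill only the region |xi| > 1, hence the separate bound B on the unit cube. *)
Lemma integral_powR_of_shell n (P : 'rV[R]_n -> R) (C B s : R) :
  measurable_fun [set: 'rV[R]_n] P -> (forall xi, 0 <= P xi) ->
  0 <= C -> 0 <= B -> (forall xi, `|xi| <= 1 -> P xi <= B) ->
  (forall k, (\int[mu n]_(xi in shell k) (P xi)%:E <= (C * 2 ^- k)%:E)%E) ->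
  n%:R / n.+1%:R < s -> s <= 1 ->
  (\int[mu n]_xi (P xi `^ s)%:E < +oo)%E.
Proof.
move=> mP P0 C0 B0 PB hP hs s1.
have s0 : 0 <= s by rewrite (le_trans _ (ltW hs))// divr_ge0.
have mPs : measurable_fun [set: 'rV[R]_n] (fun xi => P xi `^ s).
  by apply: (measurableT_comp (f := fun x : R => x `^ s)) => //; exact: measurable_powR.
pose Y : R := (2 ^+ n.+1)^-1.
have Y0 : 0 < Y by rewrite invr_gt0 exprn_gt0.
pose rho := Y `^ s * 2 ^+ n.
have rho1 : rho < 1 by exact: ratio_lt1.
have rho0 : 0 <= rho by rewrite mulr_ge0 ?powR_ge0// exprn_ge0.
(* C comes from the L^2 term; 4^n comes from the volume of the cube of side 4 * 2^k enclosing the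
   shell. With l = Y^k both terms are multiples of rho^k. *)
pose K := C + 4 ^+ n.
have shellE k : (\int[mu n]_(xi in shell k) (P xi `^ s)%:E <= (K * rho ^+ k)%:E)%E.
  have msh := @measurable_shell R n k.
  pose l := Y ^+ k.
  have l0 : 0 < l by exact: exprn_gt0.
  have ls : l `^ s = (Y `^ s) ^+ k.
    by rewrite /l powRX// ltW.
  apply: (@le_trans _ _ (\int[mu n]_(xi in shell k) ((l `^ s / l)%:E * (P xi)%:E + (l `^ s)%:E))%E).
    apply: ge0_le_integral.
    - exact: msh.
    - by move=> xi _; rewrite lee_fin powR_ge0.
    - by apply/measurable_EFinP; exact: measurable_funTS.
    - apply: emeasurable_funD => //; apply: emeasurable_funM => //.
      by apply/measurable_EFinP; exact: measurable_funTS.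
    - move=> xi _; rewrite -EFinM -EFinD lee_fin.
      apply: (le_trans (powR_le_affine (P0 xi) l0 s0 s1)).
      by rewrite mulrDr mulr1 mulrA mulrAC.
  have P0' : forall xi, shell k xi -> (0 <= (P xi)%:E)%E by move=> xi _; rewrite lee_fin.
  have mP' : measurable_fun (shell k) (fun xi => (P xi)%:E).
    by apply/measurable_EFinP; exact: measurable_funTS.
  have lsl0 : 0 <= l `^ s / l by rewrite divr_ge0 ?powR_ge0 ?(ltW l0).
  rewrite ge0_integralD//; last 3 first.
  - by move=> xi xk; rewrite mule_ge0 ?P0' ?lee_fin.
  - by apply: emeasurable_funM.
  - by move=> xi _; rewrite lee_fin powR_ge0.
  have -> : (\int[mu n]_(xi in shell k) (l `^ s)%:E = (l `^ s)%:E * mu n (shell k))%E.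
    exact: (integral_cst (mu n) msh (l `^ s)%:E).
  rewrite ge0_integralZl ?lee_fin//.
  have muk : (mu n (shell k) <= ((4 * 2 ^+ k) ^+ n)%:E)%E.
    apply: (@le_trans _ _ (mu n [set x | (`|x - 0| <= 2 ^+ k.+1)%R])).
      apply: le_measure; rewrite ?inE//; first by apply: measurable_closed_ball_rV; exact: exprn_ge0.
      by move=> x /= /andP[_]; rewrite subr0.
    rewrite (lebesgue_closed_ball_rV 0 (exprn_ge0 k.+1 (ler0n R 2))) lee_fin.
    by rewrite exprS mulrA -natrM.
  apply: (@le_trans _ _ ((l `^ s / l)%:E * (C * 2 ^- k)%:E + (l `^ s)%:E * ((4 * 2 ^+ k) ^+ n)%:E)%E).
    by apply: leeD; apply: lee_wpmul2l; rewrite ?lee_fin ?powR_ge0//.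
  rewrite -!EFinM -EFinD lee_fin.
  have -> : l `^ s / l * (C * 2 ^- k) = C * rho ^+ k.
    have lE : l^-1 = 2 ^+ k * (2 ^+ n) ^+ k by rewrite /l /Y exprVn invrK exprS exprMn.
    rewrite /rho exprMn -ls lE; move: (l `^ s) ((2 ^+ n) ^+ k) => u v; field.
    by rewrite expf_neq0.
  have -> : l `^ s * (4 * 2 ^+ k) ^+ n = 4 ^+ n * rho ^+ k.
    by rewrite /rho [in RHS]exprMn -ls [in LHS]exprMn -!exprM [in RHS]mulnC mulrCA.
  by rewrite -mulrDl.
pose F (i : nat) : set 'rV[R]_n := [set xi | `|xi| <= 2 ^+ i].
have mF i : measurable (F i).
  rewrite (_ : F i = [set x | `|x - 0| <= 2 ^+ i]).
    by apply: measurable_closed_ball_rV; exact: exprn_ge0.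
  by apply/seteqP; split => x; rewrite /F /= subr0.
pose A := B `^ s * 2 ^+ n.
have A0 : 0 <= A by rewrite mulr_ge0 ?powR_ge0 ?exprn_ge0.
have F0 : (\int[mu n]_(xi in F 0%N) (P xi `^ s)%:E <= A%:E)%E.
  apply: (@le_trans _ _ (\int[mu n]_(xi in F 0%N) (B `^ s)%:E)%E).
    apply: ge0_le_integral.
    - exact: mF.
    - by move=> xi _; rewrite lee_fin powR_ge0.
    - by apply/measurable_EFinP; exact: measurable_funTS.
    - exact: measurable_cst.
    - by move=> xi Fxi; rewrite lee_fin ge0_ler_powR// ?nnegrE//; exact: PB.
  have -> : (\int[mu n]_(xi in F 0%N) (B `^ s)%:E = (B `^ s)%:E * mu n (F 0%N))%E.
    exact: (integral_cst (mu n) (mF 0%N) (B `^ s)%:E).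
  have -> : (mu n (F 0%N) = (2 ^+ n)%:E)%E.
    rewrite -[X in X ^+ _]mulr1 -(lebesgue_closed_ball_rV 0 ler01).
    by congr (mu n _); apply/seteqP; split => x; rewrite /F /= subr0.
  by rewrite -EFinM.
(* The bound is the closed form of the partial geometric sum over shells 0 to i - 1, added to the
   contribution A of the unit cube. *)
have Fi i : (\int[mu n]_(xi in F i) (P xi `^ s)%:E <=
    (A + K * ((1 - rho ^+ i) / (1 - rho)))%:E)%E.
  elim: i => [|i IH].
    by rewrite expr0 subrr mul0r mulr0 addr0.
  have -> : F i.+1 = F i `|` shell i.
    apply/seteqP; split => x; rewrite /F /shell /=.
      by move=> h; have [h'|h'] := leP `|x| (2 ^+ i); [left|right; rewrite h].
    move=> [h|/andP[]//]; apply: (le_trans h).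
    by rewrite exprS ler_peMl ?exprn_ge0// ler1n.
  rewrite ge0_integral_setU; last 5 first.
  - exact: mF.
  - exact: measurable_shell.
  - by apply/measurable_EFinP; exact: measurable_funTS.
  - by move=> x _; rewrite lee_fin powR_ge0.
  - apply/disj_setPLR => x; rewrite /F /shell /= => xi /andP[].
    by rewrite ltNge xi.
  apply: (le_trans (leeD IH (shellE i))); rewrite -EFinD lee_fin.
  rewrite -addrA lerD2l -mulrDr ler_wpM2l ?addr_ge0 ?exprn_ge0//.
  rewrite exprS (_ : _ / _ + _ = (1 - rho * rho ^+ i) / (1 - rho))//.
  by field; rewrite subr_eq0 gt_eqF.
apply: (@le_lt_trans _ _ (A + K / (1 - rho))%:E); last exact: ltry.
have UF : \bigcup_i F i = [set: 'rV[R]_n].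
  apply/seteqP; split => // x _; exists (Num.truncn `|x|) => //.
  rewrite /F /=; have /andP[_ h] := truncn_itv (normr_ge0 x).
  rewrite (le_trans (ltW h))// -natrX ler_nat; exact: ltn_expl.
rewrite -UF.
apply: (cvge_to_le (@ge0_nondecreasing_set_cvg_integral _ _ R F
  (fun xi => (P xi `^ s)%:E) (mu n) _ _ _ _)).
- move=> i j ij; apply/subsetPset => x; rewrite /F /= => /le_trans; apply.
  by rewrite ler_weXn2l// ler1n.
- exact: mF.
- by move=> i; apply/measurable_EFinP; exact: measurable_funTS.
- by move=> i x _; rewrite lee_fin powR_ge0.
apply: nearW => i; apply: (le_trans (Fi i)); rewrite lee_fin lerD2l.
rewrite ler_wpM2l ?addr_ge0 ?exprn_ge0// ler_pdivrMr ?subr_gt0//.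
by rewrite mulVf ?subr_eq0 ?gt_eqF// gerBl exprn_ge0.
Qed.

End powR_integral.

(** * Membership of the transform in L^p *)

Section Lp_indic.
Context {R : realType}.
Local Notation mu n := (@lebesgue_rV R n).
Variables (n : nat) (f : 'rV[R]_n -> R).
Hypothesis tf : tame f.

Let U := \int[mu n]_x `|f x|.
Let mf : measurable_fun [set: 'rV[R]_n] f. Proof. by case: tf. Qed.

Lemma cosT_le xi : `|cosT f xi| <= U.
Proof.
apply: normr_Rintegral_dominated.
- by apply: measurable_funM => //; apply: measurable_cos_comp; exact: measurable_dot.
- exact: (integrable_norm (tame_integrable tf)).
- by move=> x; rewrite normrM ler_piMr// ler_norml cos_geN1 cos_le1.
Qed.

Lemma sinT_le xi : `|sinT f xi| <= U.
Proof.
apply: normr_Rintegral_dominated.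
- by apply: measurable_funM => //; apply: measurable_sin_comp; exact: measurable_dot.
- exact: (integrable_norm (tame_integrable tf)).
- by move=> x; rewrite normrM ler_piMr// ler_norml sin_geN1 sin_le1.
Qed.

Definition fourierT (xi : 'rV[R]_n) : R[i] := cosT f xi +i* (- sinT f xi).

Local Notation P xi := (cosT f xi ^+ 2 + sinT f xi ^+ 2).

Let normc_fourierT xi : Normc.normc (fourierT xi) = P xi `^ 2^-1.
Proof. by rewrite /= sqrrN powR12_sqrt// addr_ge0// sqr_ge0. Qed.

Let P0 xi : 0 <= P xi. Proof. by rewrite addr_ge0// sqr_ge0. Qed.

Lemma fourier_sqr_le xi : P xi <= U ^+ 2 + U ^+ 2.
Proof.
have U0 : 0 <= U by apply: le_trans (cosT_le 0).
by apply: lerD; rewrite -[leLHS]real_normK ?num_real// lerXn2r ?nnegrE ?cosT_le ?sinT_le.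
Qed.

Lemma measurable_cosT1 : measurable_fun [set: 'rV[R]_n] (cosT f).
Proof. by apply: (measurable_cosT (f := fun _ => f)) => //; exact: measurableT_comp. Qed.

Lemma measurable_sinT1 : measurable_fun [set: 'rV[R]_n] (sinT f).
Proof. by apply: (measurable_sinT (f := fun _ => f)) => //; exact: measurableT_comp. Qed.

(** The integrability hypothesis is applied with s = p/2, P being the squared modulus. The range p >
    2 and p = +oo are reached through the boundedness of P. *)
Lemma Lp_fourierT (p : \bar R) :
  (forall s : R, n%:R / n.+1%:R < s -> s <= 1 -> (\int[mu n]_xi (P xi `^ s)%:E < +oo)%E) ->
  (((2 * n)%:R / n.+1%:R)%:E < p)%E -> Lp p fourierT.
Proof.
move=> hP hp; split.
- exact: measurable_cosT1.
- by apply: measurable_funN; exact: measurable_sinT1.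
have mP : measurable_fun [set: 'rV[R]_n] (fun xi => P xi).
  by apply: measurable_funD; apply: measurable_funX; [exact: measurable_cosT1|exact: measurable_sinT1].
have mPs s : measurable_fun [set: 'rV[R]_n] (fun xi => P xi `^ s).
  by apply: (measurableT_comp (f := fun x : R => x `^ s)) => //; exact: measurable_powR.
case: p hp => [r|_|//].
- rewrite lte_fin => hr; rewrite unlock /=; apply: poweR_lty.
  have r0 : 0 < r by rewrite (le_lt_trans _ hr)// divr_ge0.
  have hr2 : n%:R / n.+1%:R < r / 2.
    by rewrite ltr_pdivlMr// mulrAC -natrM mulnC.
  rewrite [ltLHS](_ : _ = \int[mu n]_xi (P xi `^ (r / 2))%:E)%E; last first.
    apply: eq_integral => xi _.
    transitivity (`|(Normc.normc (fourierT xi))%:E| `^ r)%E; first by [].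
    by rewrite normc_fourierT /= ger0_norm ?powR_ge0// -powRrM (mulrC _ r).
  have [r2|r2] := lerP (r / 2) 1; first exact: hP.
  (* For r > 2, P^(r/2) <= B^(r/2 - 1) P, and s = 1 is an admissible exponent. *)
  have n1 : n%:R / n.+1%:R < 1 :> R by rewrite ltr_pdivrMr// mul1r ltr_nat.
  pose B := U ^+ 2 + U ^+ 2.
  have B0 : 0 <= B by rewrite addr_ge0// sqr_ge0.
  apply: (@le_lt_trans _ _ (\int[mu n]_xi ((B `^ (r / 2 - 1))%:E * (P xi `^ 1)%:E))%E).
    apply: ge0_le_integral.
    - by [].
    - by move=> xi _; rewrite lee_fin powR_ge0.
    - by apply/measurable_EFinP; exact: mPs.
    - by apply: emeasurable_funM => //; apply/measurable_EFinP; exact: mPs.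
    - move=> xi _; rewrite -EFinM lee_fin powRr1//.
      rewrite -mulr_powRB1//; last by rewrite (lt_trans ltr01).
      rewrite mulrC; apply: ler_wpM2r; first exact: P0.
      apply: ge0_ler_powR; [by rewrite subr_ge0 ltW|exact: P0|exact: B0|exact: fourier_sqr_le].
  rewrite ge0_integralZl//.
  + rewrite lte_mul_pinfty ?lee_fin ?powR_ge0//.
    exact: hP.
  + by apply/measurable_EFinP; exact: mPs.
  + by move=> xi _; rewrite lee_fin powR_ge0.
  + by rewrite lee_fin powR_ge0.
- rewrite unlock /=; case: ifPn => // _.
  apply: (@le_lt_trans _ _ ((U ^+ 2 + U ^+ 2) `^ 2^-1)%:E); last exact: ltry.
  apply/ess_supP; apply: nearW => xi.
  have -> : (abse \o (EFin \o @Normc.normc R \o fourierT)) xi =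
    `|(Normc.normc (fourierT xi))%:E|%E by [].
  rewrite normc_fourierT abse_EFin (ger0_norm (powR_ge0 _ _)) lee_fin.
  apply: ge0_ler_powR; [by rewrite invr_ge0|exact: P0| |exact: fourier_sqr_le].
  by rewrite nnegrE addr_ge0// sqr_ge0.
Qed.

End Lp_indic.

(** * The Fourier transform as a distribution *)

Section schwartz_integrable.
Context {R : realType}.
Local Notation leb := (@lebesgue_measure R).
Local Notation mu n := (@lebesgue_rV R n).

(** An integrable majorant for Schwartz functions; the product form makes its integral an iterated
    one, equal to pi^n. *)
Definition cauchy_weight n (x : 'rV[R]_n) : R := \prod_(i < n) (oneDsqr (x 0 i))^-1.

Lemma cauchy_weight_consrV n (x : R) (y : 'rV[R]_n) :
  cauchy_weight (consrV (x, y)) = (oneDsqr x)^-1 * cauchy_weight y.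
Proof.
rewrite /cauchy_weight [LHS](@big_split_ord _ _ _ 1 n) big_ord1 consrV_lshift.
by congr (_ * _); apply: eq_bigr => i _; rewrite consrV_rshift.
Qed.

Lemma cauchy_weight_ge0 n (x : 'rV[R]_n) : 0 <= cauchy_weight x.
Proof. by apply: prodr_ge0 => i _; rewrite invr_ge0. Qed.

Lemma measurable_oneDsqrV : measurable_fun [set: R] (fun x : R => (oneDsqr x)^-1).
Proof. by apply: continuous_measurable_fun; exact: continuous_oneDsqrV. Qed.

Lemma measurable_cauchy_weight n : measurable_fun [set: 'rV[R]_n] (@cauchy_weight n).
Proof.
apply: measurable_prod => i _.
apply: (measurableT_comp (f := fun x : R => (oneDsqr x)^-1)).
  exact: measurable_oneDsqrV.
exact: measurable_coord_rV.
Qed.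

Lemma integral_cauchy_weight n : (\int[mu n]_x (cauchy_weight x)%:E = (pi ^+ n)%:E)%E.
Proof.
elim: n => [|n IH].
  by rewrite integral_rV0 /cauchy_weight big_ord0 expr0.
rewrite ge0_integral_lebesgue_rVS; last 2 first.
- by apply/measurable_EFinP; exact: measurable_cauchy_weight.
- by move=> v; rewrite lee_fin cauchy_weight_ge0.
transitivity (\int[leb]_x ((oneDsqr x)^-1%:E * (pi ^+ n)%:E))%E.
  apply: eq_integral => x _.
  under eq_integral do rewrite cauchy_weight_consrV EFinM.
  rewrite ge0_integralZl ?IH//.
  - by apply/measurable_EFinP; exact: measurable_cauchy_weight.
  - by move=> y _; rewrite lee_fin cauchy_weight_ge0.
rewrite ge0_integralZr//.
- by rewrite integral_oneDsqrV -EFinM exprS.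
- by apply/measurable_EFinP; exact: measurable_oneDsqrV.
- by rewrite lee_fin exprn_ge0// pi_ge0.
Qed.

Lemma integrable_cauchy_weight n :
  (mu n).-integrable [set: 'rV[R]_n] (EFin \o @cauchy_weight n).
Proof.
apply/integrableP; split; first by apply/measurable_EFinP; exact: measurable_cauchy_weight.
under eq_integral do rewrite /= ger0_norm ?cauchy_weight_ge0//.
by rewrite integral_cauchy_weight ltry.
Qed.

(** Each of the n factors satisfies 1 + x_i^2 <= (1 + |x|)^2, which is the origin of the order 2n in
    [schwartz_integrable]. *)
Lemma cauchy_weight_decay n (x : 'rV[R]_n) : ((1 + `|x|) ^+ (2 * n))^-1 <= cauchy_weight x.
Proof.
rewrite exprM -exprVn -[X in _ ^+ X](card_ord n) -prodr_const.
apply: ler_prod => i _; rewrite invr_ge0 sqr_ge0 /=.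
rewrite lef_pV2; last 2 first.
- by rewrite posrE exprn_gt0// ltr_wpDr.
- by rewrite posrE (lt_le_trans ltr01)// oneDsqr_ge1.
have := rV_norm_coord x i; have := normr_ge0 (x 0 i); rewrite /oneDsqr.
rewrite -(real_normK (num_real (x 0 i))); move: (`|x 0 i|) (`|x|) => a b a0 ab.
nra.
Qed.

Lemma Re_le_normc (z : R[i]) : `|complex.Re z| <= Normc.normc z.
Proof.
by case: z => a b /=; rewrite -sqrtr_sqr ler_wsqrtr// lerDl sqr_ge0.
Qed.

Lemma Im_le_normc (z : R[i]) : `|complex.Im z| <= Normc.normc z.
Proof.
by case: z => a b /=; rewrite -sqrtr_sqr ler_wsqrtr// lerDr sqr_ge0.
Qed.

Lemma normc_le_ReIm (z : R[i]) : Normc.normc z <= `|complex.Re z| + `|complex.Im z|.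
Proof.
case: z => a b /=; rewrite -[leRHS]ger0_norm ?addr_ge0// -sqrtr_sqr ler_wsqrtr//.
rewrite -(real_normK (num_real a)) -(real_normK (num_real b)).
have := normr_ge0 a; have := normr_ge0 b; nra.
Qed.

Lemma schwartz_norm_ge n (N : nat) (phi : 'rV[R]_n -> R[i]) x :
  (((1 + `|x|) ^+ N * Normc.normc (phi x))%:E <= schwartz_norm N phi)%E.
Proof.
apply: ereal_sup_ubound; exists [::], x; split => //.
by rewrite /cpderiv /=; case: (phi x).
Qed.

Lemma schwartz_decay n (N : nat) (phi : 'rV[R]_n -> R[i]) : schwartz phi ->
  exists C : R, forall x, Normc.normc (phi x) <= C * ((1 + `|x|) ^+ N)^-1.
Proof.
move=> [_ _ /(_ N) hN]; exists (fine (schwartz_norm N phi)) => x.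
have := schwartz_norm_ge N phi x; have := schwartz_norm_ge N phi 0.
move: hN; case: (schwartz_norm N phi) => [r _ _|//|//].
by rewrite lee_fin /= ler_pdivlMr ?exprn_gt0 ?ltr_wpDr// mulrC.
Qed.

Lemma schwartz_integrable n (phi : 'rV[R]_n -> R[i]) : schwartz phi ->
  (mu n).-integrable [set: 'rV[R]_n] (EFin \o (fun x => complex.Re (phi x))) /\
  (mu n).-integrable [set: 'rV[R]_n] (EFin \o (fun x => complex.Im (phi x))).
Proof.
move=> sphi; have [C hC] := schwartz_decay (2 * n) sphi.
have [sRe sIm _] := sphi.
have i : (mu n).-integrable [set: 'rV[R]_n] (EFin \o (fun x => `|C| * cauchy_weight x)).
  exact: (integrableZl measurableT `|C| (integrable_cauchy_weight n)).
have b x : Normc.normc (phi x) <= `|C| * cauchy_weight x.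
  have d0 : 0 <= ((1 + `|x|) ^+ (2 * n))^-1 by rewrite invr_ge0 exprn_ge0// addr_ge0.
  apply: (le_trans (hC x)); apply: (@le_trans _ _ (`|C| * ((1 + `|x|) ^+ (2 * n))^-1)).
    by rewrite ler_wpM2r// ler_norm.
  by rewrite ler_wpM2l// cauchy_weight_decay.
split.
- apply: (dominated_integrable _ i).
    by apply: continuous_measurable_rV; have [] := sRe [::].
  by move=> x; apply: le_trans (b x); exact: Re_le_normc.
- apply: (dominated_integrable _ i).
    by apply: continuous_measurable_rV; have [] := sIm [::].
  by move=> x; apply: le_trans (b x); exact: Im_le_normc.
Qed.

End schwartz_integrable.

(** * Temperedness, and the distributional transform as a function *)

Section distribution.
Context {R : realType}.
Local Notation mu n := (@lebesgue_rV R n).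
Variables (n : nat) (f : 'rV[R]_n -> R).
Hypothesis tf : tame f.

Let mf : measurable_fun [set: 'rV[R]_n] f. Proof. by case: tf. Qed.
Let inf : (mu n).-integrable [set: 'rV[R]_n] (EFin \o f).
Proof. exact: tame_integrable. Qed.
Let T := distr_of (fun t => (f t)%:C).

Lemma tame_integrableM (a : 'rV[R]_n -> R) :
  (mu n).-integrable [set: 'rV[R]_n] (EFin \o a) ->
  (mu n).-integrable [set: 'rV[R]_n] (EFin \o (fun x => f x * a x)).
Proof.
move=> ia; have [_ [M [_ [fM _]]]] := tf.
apply: (dominated_integrable _ (integrableZl measurableT M (integrable_norm ia))).
  by apply: measurable_funM => //; apply/measurable_EFinP; case/integrableP: ia.
by move=> x /=; rewrite normrM ler_wpM2r.
Qed.

Lemma distr_of_real (phi : 'rV[R]_n -> R[i]) : T phi =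
  (\int[mu n]_x (f x * complex.Re (phi x))) +i* (\int[mu n]_x (f x * complex.Im (phi x))).
Proof.
rewrite /T /distr_of /cintegral; congr (_ +i* _); apply: eq_Rintegral => x _;
  case: (phi x) => a b /=; ring.
Qed.

Lemma tempered_real : tempered T.
Proof.
split => [[cr ci] phi psi /schwartz_integrable[iRe iIm] /schwartz_integrable[jRe jIm]|].
  have i1 := tame_integrableM iRe; have i2 := tame_integrableM iIm.
  have i3 := tame_integrableM jRe; have i4 := tame_integrableM jIm.
  rewrite !distr_of_real; apply/eqP; rewrite eq_complex; apply/andP; split; apply/eqP => /=.
  - rewrite -!RintegralZl// -RintegralB//; last 2 first.
    + exact: (integrableZl measurableT cr i1).
    + exact: (integrableZl measurableT ci i2).
    rewrite -RintegralD//; last first.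
      apply: (@integrableB _ _ _ (mu n) _ measurableT (fun x => (cr * (f x * complex.Re (phi x)))%:E)
        (fun x => (ci * (f x * complex.Im (phi x)))%:E)).
        exact: (integrableZl measurableT cr i1).
      exact: (integrableZl measurableT ci i2).
    apply: eq_Rintegral => x _; case: (phi x) (psi x) => a b [c d] /=; ring.
  - rewrite -!RintegralZl// -RintegralD//; last 2 first.
    + exact: (integrableZl measurableT cr i2).
    + exact: (integrableZl measurableT ci i1).
    rewrite -RintegralD//; last first.
      apply: (@integrableD _ _ _ (mu n) _ measurableT (fun x => (cr * (f x * complex.Im (phi x)))%:E)
        (fun x => (ci * (f x * complex.Re (phi x)))%:E)).
        exact: (integrableZl measurableT cr i2).
      exact: (integrableZl measurableT ci i1).
    apply: eq_Rintegral => x _; case: (phi x) (psi x) => a b [c d] /=; ring.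
pose U := \int[mu n]_x `|f x|.
(* Order 0 is enough because f is integrable; U is counted once for the real and once for the
   imaginary part. *)
exists 0%N, (U + U) => phi sphi.
have [sRe sIm /(_ 0%N)] := sphi.
have := schwartz_norm_ge 0 phi.
case: (schwartz_norm 0 phi) => [S hS _|//|/(_ 0)//].
have {}hS x : Normc.normc (phi x) <= S by have := hS x; rewrite expr0 mul1r lee_fin.
have bound (a : 'rV[R]_n -> R) : continuous a -> (forall x, `|a x| <= S) ->
    `|\int[mu n]_x (f x * a x)| <= U * S.
  move=> ca aS; rewrite -RintegralZr//; last exact: (integrable_norm inf).
  apply: normr_Rintegral_dominated.
  - by apply: measurable_funM => //; exact: continuous_measurable_rV.
  - exact: (integrableZr measurableT S (integrable_norm inf)).
  - by move=> x; rewrite normrM ler_wpM2l.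
rewrite -EFinM lee_fin distr_of_real; apply: (le_trans (normc_le_ReIm _)) => /=.
rewrite mulrDl lerD// bound//.
- by have [] := sRe [::].
- by move=> x; apply: le_trans (hS x); exact: Re_le_normc.
- by have [] := sIm [::].
- by move=> x; apply: le_trans (hS x); exact: Im_le_normc.
Qed.

(** The multiplication formula, moving the transform from phi to f, in real form. The pair (a, b) =
    (Re phi, Im phi) gives the real part of the pairing, and (Im phi, -Re phi) the imaginary
    part. *)
Let swap (a b : 'rV[R]_n -> R) :
  (mu n).-integrable [set: 'rV[R]_n] (EFin \o a) ->
  (mu n).-integrable [set: 'rV[R]_n] (EFin \o b) ->
  \int[mu n]_xi (f xi * \int[mu n]_t (a t * cos (dot xi t) + b t * sin (dot xi t))) =
  \int[mu n]_t (cosT f t * a t + sinT f t * b t).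
Proof.
move=> ia ib.
have ma : measurable_fun [set: 'rV[R]_n] a by apply/measurable_EFinP; case/integrableP: ia.
have mb : measurable_fun [set: 'rV[R]_n] b by apply/measurable_EFinP; case/integrableP: ib.
have ia' := integrable_norm ia; have ib' := integrable_norm ib.
have iab : (mu n).-integrable [set: 'rV[R]_n] (EFin \o (fun t => `|a t| + `|b t|)).
  exact: (integrableD measurableT ia' ib').
have bd xi t : `|a t * cos (dot xi t) + b t * sin (dot xi t)| <= `|a t| + `|b t|.
  rewrite (le_trans (ler_normD _ _))// !normrM lerD// ler_piMr//.
    by rewrite ler_norml cos_geN1 cos_le1.
  by rewrite ler_norml sin_geN1 sin_le1.
have mF : measurable_fun [set: 'rV[R]_n * 'rV[R]_n]
    (fun z => f z.1 * (a z.2 * cos (dot z.1 z.2) + b z.2 * sin (dot z.1 z.2))).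
  apply: measurable_funM; first exact: (measurableT_comp mf measurable_fst).
  have md : measurable_fun [set: 'rV[R]_n * 'rV[R]_n] (fun z => dot z.1 z.2) by exact: measurable_dot.
  by apply: measurable_funD; apply: measurable_funM;
    [exact: (measurableT_comp ma measurable_snd)|exact: measurable_cos_comp
    |exact: (measurableT_comp mb measurable_snd)|exact: measurable_sin_comp].
transitivity (\int[mu n]_xi \int[mu n]_t
    (f xi * (a t * cos (dot xi t) + b t * sin (dot xi t)))).
  apply: eq_Rintegral => xi _; rewrite RintegralZl//.
  apply: (dominated_integrable _ iab); last by move=> t; exact: bd.
  by apply: measurable_funD; apply: measurable_funM => //;
    [apply: measurable_cos_comp|apply: measurable_sin_comp]; exact: measurable_dot.
transitivity (\int[mu n]_t \int[mu n]_xi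
    (f xi * (a t * cos (dot xi t) + b t * sin (dot xi t)))).
  apply: (Rintegral_swap (a := fun xi => `|f xi|) (b := fun t => `|a t| + `|b t|)).
  - exact: mF.
  - exact: (integrable_norm inf).
  - exact: iab.
  - by move=> xi t; rewrite normrM ler_wpM2l.
apply: eq_Rintegral => t _; rewrite /cosT /sinT.
have ic : (mu n).-integrable [set: 'rV[R]_n] (EFin \o (fun x => f x * cos (dot x t))).
  by apply: integrableM_cos => //; exact: measurable_dot.
have is' : (mu n).-integrable [set: 'rV[R]_n] (EFin \o (fun x => f x * sin (dot x t))).
  by apply: integrableM_sin => //; exact: measurable_dot.
rewrite -!RintegralZr// -RintegralD//.
- by apply: eq_Rintegral => x _; ring.
- exact: (integrableZr measurableT (a t) ic).
- exact: (integrableZr measurableT (b t) is').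
Qed.

Lemma fourier_distr_real (phi : 'rV[R]_n -> R[i]) : schwartz phi ->
  fourier_distr T phi = distr_of (fourierT f) phi.
Proof.
move=> /schwartz_integrable[iRe iIm].
rewrite /fourier_distr distr_of_real /distr_of /cintegral; congr (_ +i* _).
- transitivity (\int[mu n]_t (cosT f t * complex.Re (phi t) + sinT f t * complex.Im (phi t))).
    rewrite -(swap iRe iIm); apply: eq_Rintegral => xi _; congr (_ * _) => /=.
    apply: eq_Rintegral => t _; rewrite /expi cosN sinN.
    by case: (phi t) => a b /=; ring.
  apply: eq_Rintegral => t _; case: (phi t) => a b /=; ring.
- have iN : (mu n).-integrable [set: 'rV[R]_n] (EFin \o (fun x => - complex.Re (phi x))).
    exact: (integrableN iRe).
  transitivity (\int[mu n]_t (cosT f t * complex.Im (phi t) + sinT f t * - complex.Re (phi t))).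
    rewrite -(swap iIm iN); apply: eq_Rintegral => xi _; congr (_ * _) => /=.
    apply: eq_Rintegral => t _; rewrite /expi cosN sinN.
    by case: (phi t) => a b /=; ring.
  apply: eq_Rintegral => t _; case: (phi t) => a b /=; ring.
Qed.

End distribution.

Theorem theorem1 (R : realType) (n : nat) (D : set 'rV[R]_n) :
  (2 <= n)%N -> domain D -> bounded_set D -> C1_boundary D ->
  forall p : \bar R, (((2 * n)%:R / n.+1%:R)%:E < p)%E ->
    in_A p (distr_of (fun t => (\1_D t)%:C)).
Proof.
move=> n2 [_ oD _] bD C1 p hp.
have n0 : (0 < n)%N by exact: ltnW.
have tD : tame (\1_D : 'rV[R]_n -> R) by exact: tame_indic.
split; first exact: tempered_real.
exists (fourierT \1_D); last by move=> phi sphi; exact: fourier_distr_real.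
apply: Lp_fourierT => // s hs s1.
have [C C0 hC] := shell_estimate oD bD n0 (covered_C1_boundary bD C1).
pose U : R := \int[@lebesgue_rV R n]_x `|\1_D x|.
(* The unit cube is covered by the trivial bound: both [cosT] and [sinT] are at most U in absolute
   value. *)
apply: (@integral_powR_of_shell _ _ _ C (U ^+ 2 + U ^+ 2)) => //.
- apply: measurable_funD; apply: measurable_funX.
    exact: measurable_cosT1.
  exact: measurable_sinT1.
- by move=> xi; rewrite addr_ge0// sqr_ge0.
- by rewrite addr_ge0// sqr_ge0.
- by move=> xi _; exact: fourier_sqr_le.
Qed.
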